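(* Let $n\ge2$, $\upsilon\in(0,\infty]$, and let $F$ be a spherically symmetric Finsler metric on $\mathbb{B}^n(\upsilon)=\{x\in\mathbb{R}^n:|x|<\upsilon\}$. Then $F$ is a weakly-Weyl Finsler metric if and only if $F$ is $W$-quadratic.
   Context: A Finsler metric $F$ on $\mathbb{B}^n(\upsilon)$ is spherically symmetric if $F(Ax,Ay)=F(x,y)$ for all $x\in\mathbb{B}^n(\upsilon)$, $y\in T_x\mathbb{B}^n(\upsilon)$ and $A\in O(n)$. Equivalently, $F=|y|\,\varphi\big(|x|,\frac{\langle x,y\rangle}{|y|}\big)$ for some function $\varphi:[0,\upsilon)\times\mathbb{R}\to\mathbb{R}$. Let $F$ be a Finsler metric on an $n$-dimensional manifold $M$ with standard local coordinates $(x^i,y^i)$ on $TM$; all tensors below live on $TM\setminus\{0\}$. A subscript ''$._k$'' denotes $\partial/\partial y^k$. The spray coefficients are $G^i=\frac14 g^{il}\{(F^2)_{x^ky^l}y^k-(F^2)_{x^l}\}$, where $g_{ij}=\frac12(F^2)_{y^iy^j}$. A subscript ''$|_m$'' denotes the horizontal covariant derivative of the Berwald connection of $F$; e.g. with $N^r{}_m=G^r{}_{.m}$ and $G^i{}_{rm}=G^i{}_{.r.m}$, $T^i{}_{j|m}=\partial_{x^m}T^i{}_j-N^r{}_mT^i{}_{j.r}+G^i{}_{rm}T^r{}_j-G^r{}_{jm}T^i{}_r$, and similarly for other tensors. The subscript $0$ denotes contraction with $y$, e.g. $T_{|0}=T_{|m}y^m$. Riemann curvature: $R^i{}_k=2\frac{\partial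 G^i}{\partial x^k}-\frac{\partial^2G^i}{\partial x^m\partial y^k}y^m+2G^m\frac{\partial^2G^i}{\partial y^m\partial y^k}-\frac{\partial G^i}{\partial y^m}\frac{\partial G^m}{\partial y^k}$. Weyl curvature: $W^i{}_k=A^i{}_k-\frac1{n+1}A^m{}_{k.m}y^i$, where $A^i{}_k=R^i{}_k-R\,\delta^i{}_k$ and $R=\frac1{n-1}R^m{}_m$. Set $W_j{}^i{}_{pl}=\frac13\big(W^i{}_{p.l}-W^i{}_{l.p}\big)_{.j}$. Weakly-Weyl curvature: $\tilde W_j{}^i{}_{kl}=W_j{}^i{}_{pl.k}\,y^p$. $F$ is a weakly-Weyl Finsler metric if $\tilde W_j{}^i{}_{kl}=\omega_{jkl}\,y^i$ for some tensor $\omega_{jkl}=\omega_{jkl}(x,y)$ satisfying $\omega_{jkl|0}+\mu F\omega_{jkl}=0$ for some scalar function $\mu$ on $TM\setminus\{0\}$. $F$ is $W$-quadratic if at every point $x$ the components $W^i{}_k(x,y)$ are quadratic in $y$ (equivalently, $W_j{}^i{}_{kl}$ depends only on $x$). *)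

(* Defs.v *)
From mathcomp Require Import all_boot all_order all_algebra.
From mathcomp Require Import all_classical all_reals all_analysis.

Set Implicit Arguments.
Unset Strict Implicit.
Unset Printing Implicit Defensive.
Import Order.TTheory GRing.Theory Num.Theory.
Import numFieldNormedType.Exports.
Local Open Scope classical_set_scope.
Local Open Scope ring_scope.

(** Finsler geometry on a domain [D] of R^n in its standard global chart.
    A point of TM is a pair [(x, y)] of row vectors, and scalar functions on TM
    are total functions on R^n * R^n of which only the values over [D] matter.
    Tensors are families of component functions, upper indices before lower
    ones unless the name of the tensor dictates otherwise. *)

Section FinslerDefs.
Context {R : realType} {n : nat}.

Local Notation TRn := ('rV[R]_n * 'rV[R]_n)%type.

Implicit Types (D : set 'rV[R]_n) (F f : TRn -> R) (p : TRn)
  (h i j k l m r : 'I_n).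

(* The norm [`|x|] that the library puts on 'rV[R]_n is the sup norm. *)
Definition enorm (x : 'rV[R]_n) : R := Num.sqrt (\sum_i x 0 i ^+ 2).

Definition eball (v : \bar R) : set 'rV[R]_n := [set x | ((enorm x)%:E < v)%E].

Definition slit D : set TRn := [set p | D p.1 /\ p.2 != 0].

Definition dx k f : TRn -> R := fun p => 'D_((delta_mx 0 k, 0) : TRn) f p.
Definition dy k f : TRn -> R := fun p => 'D_((0, delta_mx 0 k) : TRn) f p.

(* For U open this is the usual class C^q on U: all iterated directional
   derivatives of order at most q exist and are continuous on U. *)
Fixpoint Ck (q : nat) (U : set TRn) f : Prop :=
  (forall p, U p -> {for p, continuous f}) /\
  if q is q'.+1 then
    forall v : TRn, (forall p, U p -> derivable f p v) /\
                    Ck q' U (fun p => 'D_v f p)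
  else True.

Definition smooth_on (U : set TRn) f : Prop := forall q, Ck q U f.

Definition sqF F : TRn -> R := fun p => F p ^+ 2.

Definition fundamental F p : 'M[R]_n :=
  \matrix_(i, j) (2^-1 * dy j (dy i (sqF F)) p).

Record finsler_metric D F : Prop := FinslerMetric {
  finsler_ge0 : forall x y, D x -> 0 <= F (x, y);
  finsler_smooth : smooth_on (slit D) F;
  finsler_homogeneous : forall x y (a : R),
    D x -> 0 < a -> F (x, a *: y) = a * F (x, y);
  finsler_posdef : forall p, slit D p -> forall u : 'rV[R]_n,
    u != 0 -> 0 < (u *m fundamental F p *m u^T) 0 0 }.

(* O(n) acts on row vectors by right multiplication. *)
Definition spherically_symmetric D F : Prop :=
  forall A : 'M[R]_n, A *m A^T = 1%:M ->
  forall x y, D x -> F (x *m A, y *m A) = F (x, y).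

(* G^i *)
Definition spray F i : TRn -> R := fun p =>
  4^-1 * \sum_l invmx (fundamental F p) i l *
    (\sum_k dy l (dx k (sqF F)) p * p.2 0 k - dx l (sqF F) p).

(* N^r_m *)
Definition nonlin_conn F r m : TRn -> R := dy m (spray F r).

(* G^i_{rm} *)
Definition berwald_conn F i r m : TRn -> R := dy m (dy r (spray F i)).

(* R^i_k *)
Definition riemann F i k : TRn -> R := fun p =>
  2 * dx k (spray F i) p
  - \sum_m dx m (dy k (spray F i)) p * p.2 0 m
  + 2 * \sum_m spray F m p * dy m (dy k (spray F i)) p
  - \sum_m dy m (spray F i) p * dy k (spray F m) p.

Definition ricci_scalar F : TRn -> R := fun p =>
  (n%:R - 1)^-1 * \sum_m riemann F m m p.

(* A^i_k *)
Definition weyl_aux F i k : TRn -> R := fun p =>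
  riemann F i k p - ricci_scalar F p * (i == k)%:R.

(* W^i_k *)
Definition weyl F i k : TRn -> R := fun p =>
  weyl_aux F i k p - (n%:R + 1)^-1 * (\sum_m dy m (weyl_aux F m k) p) * p.2 0 i.

(* W_j^i_{hl} *)
Definition weyl4 F j i h l : TRn -> R :=
  dy j (fun p => 3^-1 * (dy l (weyl F i h) p - dy h (weyl F i l) p)).

(* ~W_j^i_{kl} *)
Definition weakly_weyl_curv F j i k l : TRn -> R := fun p =>
  \sum_h dy k (weyl4 F j i h l) p * p.2 0 h.

(* T_{jkl|m}, for the Berwald connection of F *)
Definition hcov F (T : 'I_n -> 'I_n -> 'I_n -> TRn -> R) j k l m : TRn -> R :=
  fun p =>
    dx m (T j k l) p
    - \sum_r nonlin_conn F r m p * dy r (T j k l) p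
    - \sum_r berwald_conn F r j m p * T r k l p
    - \sum_r berwald_conn F r k m p * T j r l p
    - \sum_r berwald_conn F r l m p * T j k r p.

(* T_{jkl|0} *)
Definition hcov0 F (T : 'I_n -> 'I_n -> 'I_n -> TRn -> R) j k l : TRn -> R :=
  fun p => \sum_m hcov F T j k l m p * p.2 0 m.

Definition weakly_weyl D F : Prop :=
  exists omega : 'I_n -> 'I_n -> 'I_n -> TRn -> R,
  [/\ forall j k l, smooth_on (slit D) (omega j k l),
      forall j i k l p, slit D p ->
        weakly_weyl_curv F j i k l p = omega j k l p * p.2 0 i
    & exists mu : TRn -> R, forall j k l p, slit D p ->
        hcov0 F omega j k l p + mu p * F p * omega j k l p = 0].

Definition W_quadratic D F : Prop :=
  forall x, D x -> forall i k, exists Q : 'M[R]_n,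
  forall y, y != 0 -> weyl F i k (x, y) = \sum_a \sum_b Q a b * y 0 a * y 0 b.

End FinslerDefs.

(* Main.v *)
(* Differentiating [W^i_k y^k = 0] three times shows that [-3 ~W_j^i_{kl}] is the
   cyclic sum of [W^i_{l.j.k}], so being weakly-Weyl means that this sum is a
   multiple of [y^i].  By symmetry it suffices to look at [x = r e_o].  If n >= 3,
   equivariance of [W] under the reflections fixing [x] and [y] gives, for generic
   [y], [W^i_k = a delta^i_k + eta_k y^i + gamma_k delta^i_o] with smooth
   coefficients.  Modulo [y], the cyclic sum condition then reads
   [a_{.j.k} + eta_{j.k} + eta_{k.j} = 0], together with the vanishing of the cyclic
   sum of [gamma_{l.j.k}].  The latter forces [gamma_{l.j.k.m} = 0], hence
   [a_{.j.k.m} = 0], because [tr W = 0] and [W y = 0] give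
   [(n - 1) a + gamma_o = 0]; then [eta_{j.k.m}], symmetric in [k, m] and
   antisymmetric in [j, k], vanishes as well, and [W] has no third derivative in [y].
   For n = 2 the Weyl curvature is zero: there [y^i A^j_k = y^j A^i_k], and taking the
   divergence over [j] gives [W = 0]. *)

(* At [x = r e_o] the vector [z = y_q e_p - y_p e_q], with distinct [p], [q] other than [o], is
   orthogonal to [x] and to [y]. Its reflection fixes the point [(x, y)], so [W(x, y)] commutes with
   that reflection and has [z] as an eigenvector, and so has its transpose. Such a [z] takes two
   indices besides [o], which is why [n = 2] is treated apart. Solving for the coefficients divides
   by the [y^i] with [i <> o]; the argument therefore runs on the open set where these do not vanish
   and is extended by continuity at the end. The unknown multiple of [y^i] in the cyclic sum is
   eliminated by comparing the components [p1] and [p2]. What remains is the symmetric product of a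
   nonzero covector with the form [a_{.j.k} + eta_{j.k} + eta_{k.j}], and such a product vanishes
   only if the form does. *)
Require Import Defs.
From mathcomp Require Import all_boot all_order all_algebra.
From mathcomp Require Import all_classical all_reals all_analysis.
From mathcomp Require Import ring lra.

Set Implicit Arguments.
Unset Strict Implicit.
Unset Printing Implicit Defensive.
Import Order.TTheory GRing.Theory Num.Theory.
Import numFieldNormedType.Exports.
Local Open Scope classical_set_scope.
Local Open Scope ring_scope.

(** * Directional derivatives *)

Section DirectionalDerivatives.
Context {R : realType} {V : normedModType R}.
Implicit Types (f g : V -> R) (p q u v w : V).

(** Directional derivatives need not be linear in the direction. Homogeneity comes from substituting
    [h * c] for [h], which preserves punctured neighbourhoods of [0] when [c != 0]. *)
Lemma derive_scale_dir f p v (c : R) : derivable f p v ->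
  derivable f p (c *: v) /\ 'D_(c *: v) f p = c * 'D_v f p.
Proof.
have [->|c0] := eqVneq c 0.
  by move=> _; rewrite scale0r mul0r derive0; split=> //; exact: derivable0.
move=> fv.
suff H : (fun h => h^-1 *: ((f \o shift p) (h *: (c *: v)) - f p)) @ 0^' -->
    c * 'D_v f p.
  by split; [apply/cvg_ex; exists (c * 'D_v f p) | exact: cvg_lim H].
have -> : (fun h => h^-1 *: ((f \o shift p) (h *: (c *: v)) - f p)) =
  (fun h => c * ((fun h => h^-1 *: ((f \o shift p) (h *: v) - f p)) \o
                 (fun h => h * c)) h).
  apply/funext => h /=.
  by rewrite scalerA /GRing.scale /= invfM mulrA mulrCA divff // mulr1.
apply: (cvgM (cvg_cst c)).
apply: (@cvg_comp _ _ _ (fun h : R => h * c) _ 0^' (0^' : set_system R) ); last exact: fv.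
move=> A A0; change (\forall h \near (0 : R), h != 0 -> A (h * c)).
have H : \forall h \near (0 : R), h * c != 0 -> A (h * c).
  apply: (@mulrr_continuous _ c 0 [set z | z != 0 -> A z]).
  by rewrite mul0r.
by apply: filterS H => h H h0; apply: H; rewrite mulf_neq0.
Qed.

Lemma is_derive_line f p v (t : R) : derivable f (p + t *: v) v ->
  is_derive t 1 (fun s : R => f (p + s *: v)) ('D_v f (p + t *: v)).
Proof.
move=> fv.
have E : (fun h : R => h^-1 *: (((fun s : R => f (p + s *: v)) \o shift t) (h *: 1)
     - f (p + t *: v))) =
  (fun h : R => h^-1 *: ((f \o shift (p + t *: v)) (h *: v) - f (p + t *: v))).
  apply/funext => h /=; congr (_ *: (f _ - _)).
  by rewrite scalerDl [_ *: 1]mulr1 addrCA.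
by split; rewrite /derivable /derive E.
Qed.

Lemma MVT_line f p v :
  (forall t : R, t \in `[0, 1] -> derivable f (p + t *: v) v) ->
  exists2 t : R, t \in `[0, 1] & f (p + v) - f p = 'D_v f (p + t *: v).
Proof.
move=> fv.
have [||t t01] := @MVT_segment R (fun s => f (p + s *: v))
   (fun t => 'D_v f (p + t *: v)) 0 1 ler01.
- by move=> x x01; apply/is_derive_line/fv; exact: subset_itv_oo_cc.
- apply: derivable_within_continuous => x x01.
  by have [] := is_derive_line (fv _ x01).
rewrite scale1r scale0r addr0 subr0 mulr1 => E.
by exists t.
Qed.

(** The increment is split at [p + h *: u]. By the mean value theorem the second piece is ['D_v f]
    at a point tending to [p], where this derivative is continuous. *)
Lemma derive_add_dir f p u v :
  (\forall q \near p, derivable f q v) ->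
  (forall e : R, 0 < e -> \forall q \near p, `|'D_v f p - 'D_v f q| < e) ->
  derivable f p u ->
  derivable f p (u + v) /\ 'D_(u + v) f p = 'D_u f p + 'D_v f p.
Proof.
move=> fv cv fu.
suff H : (fun h => h^-1 *: ((f \o shift p) (h *: (u + v)) - f p)) @ 0^' -->
    'D_u f p + 'D_v f p.
  by split; [apply/cvg_ex; exists ('D_u f p + 'D_v f p) | exact: cvg_lim H].
have -> : (fun h => h^-1 *: ((f \o shift p) (h *: (u + v)) - f p)) =
  (fun h => (h^-1 *: ((f \o shift p) (h *: u) - f p)) +
            (h^-1 *: (f (p + h *: u + h *: v) - f (p + h *: u)))).
  apply/funext => h /=; rewrite -scalerDr; congr (_ *: _).
  by rewrite scalerDr (addrC _ p) (addrC (h *: u) p) addrA; ring.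
apply: cvgD; first exact: fu.
apply/cvgrPdist_lt => e e0.
have [d /= d0 H] : \forall d \near 0^'+, forall q, ball p d q ->
    derivable f q v /\ `|'D_v f p - 'D_v f q| < e.
  have : \forall q \near p, derivable f q v /\ `|'D_v f p - 'D_v f q| < e.
    near=> q; split; first by near: q.
    by near: q; exact: cv.
  move=> /nbhs_ballP[d /= d0 H]; near=> d' => q pq; apply: H.
  by apply: le_ball pq; near: d'; exact: nbhs_right_le.
(* The previous [H] covers the radii strictly below [d], hence the choice of [d / 2]. *)
have {}H : forall q, `|p - q| < d / 2 ->
    derivable f q v /\ `|'D_v f p - 'D_v f q| < e.
  move=> q pq; apply: (H (d / 2)); last by rewrite -ball_normE.
  - by rewrite /ball /= sub0r normrN gtr0_norm ?divr_gt0// ltr_pdivrMr// ltr_pMr// ltr1n.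
  - by rewrite divr_gt0.
have M0 : 0 < `|u| + `|v| + 1 by rewrite ltr_wpDl.
near=> h.
have h0 : h != 0 by near: h; exact: nbhs_dnbhs_neq.
have hd : `|h| * (`|u| + `|v| + 1) < d / 2.
  rewrite -ltr_pdivlMr //; near: h; apply: dnbhs0_lt.
  by rewrite !divr_gt0.
have K (t : R) : t \in `[0, 1] -> `|p - (p + h *: u + t *: (h *: v))| < d / 2.
  rewrite in_itv /= => /andP[t0 t1].
  apply: le_lt_trans hd; rewrite -addrA opprD addNKr normrN.
  apply: (le_trans (ler_normD _ _)); rewrite !normrZ (ger0_norm t0) -addrA mulrDr lerD2l.
  rewrite mulrDr mulr1; apply: ler_wpDr => //.
  by apply: ler_piMl => //; exact: mulr_ge0.
have [t t01 ->] := @MVT_line f (p + h *: u) (h *: v) (fun t t01 =>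
   (derive_scale_dir h (H _ (K t t01)).1).1).
rewrite (derive_scale_dir h (H _ (K t t01)).1).2 [_ *: _]mulrA mulVf// mul1r.
exact: (H _ (K t t01)).2.
Unshelve. all: by end_near. Qed.

(** Both mixed derivatives compute the second difference of [f] over the parallelogram on [u] and
    [v], each at its own intermediate point. *)
Lemma schwarz_segment f p u v :
  (forall s t : R, s \in `[0, 1] -> t \in `[0, 1] ->
    [/\ derivable f (p + s *: u + t *: v) u,
        derivable f (p + s *: u + t *: v) v,
        derivable ('D_u f) (p + s *: u + t *: v) v &
        derivable ('D_v f) (p + s *: u + t *: v) u]) ->
  exists s t s' t' : R,
    [/\ s \in `[0, 1], t \in `[0, 1], s' \in `[0, 1], t' \in `[0, 1] &
    'D_v ('D_u f) (p + s *: u + t *: v) = 'D_u ('D_v f) (p + s' *: u + t' *: v)].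
Proof.
move=> H.
have i0 : (0 : R) \in `[0, 1] by rewrite in_itv/= lexx ler01.
have i1 : (1 : R) \in `[0, 1] by rewrite in_itv/= lexx ler01.
(* The mean value theorem is applied to [f (q + b) - f q] along [a], then to ['D_a f] along [b]. *)
have key (a b : V) : (forall s t : R, s \in `[0, 1] -> t \in `[0, 1] ->
    derivable f (p + s *: a + t *: b) a /\
    derivable ('D_a f) (p + s *: a + t *: b) b) ->
  exists s t : R, [/\ s \in `[0, 1], t \in `[0, 1] &
   f (p + a + b) - f (p + a) - (f (p + b) - f p) =
    'D_b ('D_a f) (p + s *: a + t *: b)].
  move=> K.
  have dB (s : R) : derivable f (p + s *: a + b) a ->
     is_derive (p + s *: a) a (fun q => f (q + b)) ('D_a f (p + s *: a + b)).
    move=> fa; have E : (fun h : R => h^-1 *: (((fun q => f (q + b)) \o shift (p + s *: a)) (h *: a)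
       - f (p + s *: a + b))) =
      (fun h : R => h^-1 *: ((f \o shift (p + s *: a + b)) (h *: a) - f (p + s *: a + b))).
      by apply/funext => h /=; rewrite !addrA.
    by split; rewrite /derivable /derive E.
  have d1 (s : R) : s \in `[0, 1] -> derivable f (p + s *: a + b) a.
    by move=> s01; have [] := K s 1 s01 i1; rewrite scale1r.
  have d0 (s : R) : s \in `[0, 1] -> derivable f (p + s *: a) a.
    by move=> s01; have [] := K s 0 s01 i0; rewrite scale0r addr0.
  have [s s01] := @MVT_line (fun q => f (q + b) - f q) p a (fun t t01 =>
    derivableB (@ex_derive _ _ _ _ _ _ _ (dB t (d1 t t01))) (d0 t t01)).
  have -> := @deriveB _ _ _ (fun q => f (q + b)) f _ a
     (@ex_derive _ _ _ _ _ _ _ (dB s (d1 s s01))) (d0 s s01).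
  rewrite (@derive_val _ _ _ _ _ _ _ (dB s (d1 s s01))).
  have [t t01 ->] := @MVT_line ('D_a f) (p + s *: a) b (fun t t01 => (K s t s01 t01).2).
  by move=> E; exists s, t; split.
have [s [t [s01 t01 E1]]] := key u v (fun s t s01 t01 => let: And4 a _ b _ := H s t s01 t01 in conj a b).
have K2 : forall s t : R, s \in `[0, 1] -> t \in `[0, 1] ->
    derivable f (p + s *: v + t *: u) v /\
    derivable ('D_v f) (p + s *: v + t *: u) u.
  by move=> a b a01 b01; rewrite (addrAC p (a *: v)); have [_ h _ k] := H b a b01 a01.
have [t' [s' [t01' s01' E2]]] := key v u K2.
exists s, t, s', t'; split; [exact: s01|exact: t01|exact: s01'|exact: t01'|].
rewrite -E1 [p + s' *: u + t' *: v]addrAC -E2 (addrAC p v u).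
by move: (f (p + u + v)) (f (p + u)) (f (p + v)) (f p) => x y z w; ring.
Qed.

(** The two difference quotients are the same function of [h]. *)
Lemma derive_linear_map (W : normedModType R) (L : V -> W) (f : W -> R) p v :
  (forall (a : R) u w, L (a *: u + w) = a *: L u + L w) ->
  'D_v (f \o L) p = 'D_(L v) f (L p).
Proof.
move=> linL; rewrite /derive.
suff -> : (fun h : R => h^-1 *: ((f \o L \o shift p) (h *: v) - (f \o L) p)) =
   (fun h : R => h^-1 *: ((f \o shift (L p)) (h *: L v) - f (L p))) by [].
by apply/funext => h /=; rewrite linL.
Qed.

End DirectionalDerivatives.

(** * Smooth functions on an open set of the tangent bundle, and Schwarz's theorem *)

Section SmoothFunctions.
Context {R : realType} {n : nat}.
Local Notation TRn := ('rV[R]_n * 'rV[R]_n)%type.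
Implicit Types (f g : TRn -> R) (p u v w : TRn).
Variable U : set TRn.
Hypothesis oU : open U.

Lemma near_open p (P : TRn -> Prop) :
  U p -> (forall q, U q -> P q) -> \forall q \near p, P q.
Proof. by move=> Up UP; apply: filterS UP _; exact: open_nbhs_nbhs. Qed.

Lemma Ck_continuous q f p : Ck q U f -> U p -> {for p, continuous f}.
Proof. by case: q => [|q] [cf _]; exact: cf. Qed.

Lemma Ck_ext q f g : (forall p, U p -> f p = g p) -> Ck q U f -> Ck q U g.
Proof.
elim: q f g => [|q IH] f g fg [cf df].
all: have cg p : U p -> {for p, continuous g}.
1,3: move=> Up; have := cf p Up; rewrite /prop_for /continuous_at (fg p Up).
1,2: by apply: cvg_trans; apply: near_eq_cvg; exact: (near_open Up).
  by split.
split=> // v; have [dv Cv] := df v; split.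
  by move=> p Up; apply: near_eq_derivable (dv p Up); exact: (near_open Up).
by apply: IH Cv => p Up; apply: near_eq_derive; exact: (near_open Up).
Qed.

Lemma Ck_le q f : Ck q.+1 U f -> Ck q U f.
Proof.
elim: q f => [|q IH] f [cf df]; first by split.
by split=> // v; have [dv Cv] := df v; split=> //; exact: IH.
Qed.

Lemma Ck_cst q (c : R) : Ck q U (fun=> c).
Proof.
have cc p : U p -> {for p, continuous (fun=> c : R)} by move=> _; exact: cvg_cst.
elim: q c cc => [|q IH] c cc; split=> // v; split.
  by move=> p _; exact: derivable_cst.
apply: (@Ck_ext _ (fun=> 0)) => [p _|]; first by rewrite derive_cst.
by apply: IH => p _; exact: cvg_cst.
Qed.

Lemma CkD q f g : Ck q U f -> Ck q U g -> Ck q U (fun p => f p + g p).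
Proof.
elim: q f g => [|q IH] f g [cf df] [cg dg].
all: have cs p : U p -> {for p, continuous (fun p => f p + g p)}.
1,3: by move=> Up; apply: cvgD; [exact: cf|exact: cg].
  by split.
split=> // v; have [dfv Cfv] := df v; have [dgv Cgv] := dg v; split.
  by move=> p Up; apply: derivableD; [exact: dfv|exact: dgv].
apply: Ck_ext (IH _ _ Cfv Cgv) => p Up.
by rewrite [RHS]deriveD; [|exact: dfv|exact: dgv].
Qed.

Lemma CkM q f g : Ck q U f -> Ck q U g -> Ck q U (fun p => f p * g p).
Proof.
elim: q f g => [|q IH] f g Cf Cg; have [cf df] := Cf; have [cg dg] := Cg.
all: have cs p : U p -> {for p, continuous (fun p => f p * g p)}.
1,3: by move=> Up; apply: cvgM; [exact: cf|exact: cg].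
  by split.
split=> // v; have [dfv Cfv] := df v; have [dgv Cgv] := dg v; split.
  by move=> p Up; apply: derivableM; [exact: dfv|exact: dgv].
apply: Ck_ext (CkD (IH _ _ (Ck_le Cf) Cgv) (IH _ _ (Ck_le Cg) Cfv)) => p Up.
by rewrite [RHS]deriveM; [|exact: dfv|exact: dgv].
Qed.

Lemma CkV q f : (forall p, U p -> f p != 0) -> Ck q U f ->
  Ck q U (fun p => (f p)^-1).
Proof.
move=> f0; elim: q => [|q IH] Cf; have [cf df] := Cf.
all: have cs p : U p -> {for p, continuous (fun p => (f p)^-1)}.
1,3: by move=> Up; apply: cvgV; [exact: f0|exact: cf].
  by split.
split=> // v; have [dfv Cfv] := df v; split.
  by move=> p Up; apply: derivableV; [exact: f0|exact: dfv].
(* The derivative of the inverse contains the inverse again, needed one class lower. *)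
have CV := IH (Ck_le Cf).
apply: Ck_ext (CkM (CkM (CkM (Ck_cst q (-1)) CV) CV) Cfv) => p Up.
rewrite [RHS]deriveV; [|exact: f0|exact: dfv].
by rewrite [RHS]/GRing.scale /= expr2 invfM mulN1r mulNr.
Qed.

Lemma smooth_continuous f p : smooth_on U f -> U p -> {for p, continuous f}.
Proof. by move=> /(_ 0%N) /Ck_continuous; apply. Qed.

Lemma smooth_derivable f p v : smooth_on U f -> U p -> derivable f p v.
Proof. by move=> /(_ 1%N)[_ /(_ v)[+ _]]; apply. Qed.

Lemma smooth_derive f v : smooth_on U f -> smooth_on U ('D_v f).
Proof. by move=> sf q; have [_ /(_ v)[]] := sf q.+1. Qed.

Lemma smooth_ext f g : (forall p, U p -> f p = g p) ->
  smooth_on U f -> smooth_on U g.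
Proof. by move=> fg sf q; exact: Ck_ext (sf q). Qed.

Lemma smooth_cst (c : R) : smooth_on U (fun=> c).
Proof. by move=> q; exact: Ck_cst. Qed.

Lemma smoothD f g : smooth_on U f -> smooth_on U g ->
  smooth_on U (fun p => f p + g p).
Proof. by move=> sf sg q; exact: CkD. Qed.

Lemma smoothM f g : smooth_on U f -> smooth_on U g ->
  smooth_on U (fun p => f p * g p).
Proof. by move=> sf sg q; exact: CkM. Qed.

Lemma smoothV f : (forall p, U p -> f p != 0) -> smooth_on U f ->
  smooth_on U (fun p => (f p)^-1).
Proof. by move=> f0 sf q; exact: CkV. Qed.

Lemma smoothN f : smooth_on U f -> smooth_on U (fun p => - f p).
Proof.
by move=> sf; apply: smooth_ext (smoothM (smooth_cst (-1)) sf) => p _; rewrite mulN1r.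
Qed.

Lemma smoothB f g : smooth_on U f -> smooth_on U g ->
  smooth_on U (fun p => f p - g p).
Proof. by move=> sf sg; apply: smoothD => //; exact: smoothN. Qed.

Lemma smoothX f m : smooth_on U f -> smooth_on U (fun p => f p ^+ m).
Proof.
move=> sf; elim: m => [|m IH].
  by apply: smooth_ext (smooth_cst 1) => p _; rewrite expr0.
by apply: smooth_ext (smoothM sf IH) => p _; rewrite exprS.
Qed.

Lemma smooth_sum (I : Type) (r : seq I) (P : pred I) (f : I -> TRn -> R) :
  (forall i, P i -> smooth_on U (f i)) ->
  smooth_on U (fun p => \sum_(i <- r | P i) f i p).
Proof.
move=> sf; elim: r => [|i r IH].
  by apply: smooth_ext (smooth_cst 0) => p _; rewrite big_nil.
case Pi : (P i); last by apply: smooth_ext IH => p _; rewrite big_cons Pi.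
by apply: smooth_ext (smoothD (sf i Pi) IH) => p _; rewrite big_cons Pi.
Qed.

Lemma smooth_prod (I : Type) (r : seq I) (P : pred I) (f : I -> TRn -> R) :
  (forall i, P i -> smooth_on U (f i)) ->
  smooth_on U (fun p => \prod_(i <- r | P i) f i p).
Proof.
move=> sf; elim: r => [|i r IH].
  by apply: smooth_ext (smooth_cst 1) => p _; rewrite big_nil.
case Pi : (P i); last by apply: smooth_ext IH => p _; rewrite big_cons Pi.
by apply: smooth_ext (smoothM (sf i Pi) IH) => p _; rewrite big_cons Pi.
Qed.

Lemma derive_snd_coord i p v : is_derive p v (fun p : TRn => p.2 0 i) (v.2 0 i).
Proof.
have E : (fun h : R => h^-1 *: (((fun p : TRn => p.2 0 i) \o shift p) (h *: v) - p.2 0 i)) @ 0^'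
   --> v.2 0 i.
  apply: (@cvg_trans _ ((fun=> v.2 0 i) @ (0^' : set_system R))); last exact: cvg_cst.
  apply: near_eq_cvg; near=> h.
  have h0 : h != 0 by near: h; exact: nbhs_dnbhs_neq.
  by rewrite /= !mxE addrK /GRing.scale /= mulKf.
split; first by apply/cvg_ex; exists (v.2 0 i).
exact: cvg_lim E.
Unshelve. all: by end_near. Qed.

Lemma smooth_snd_coord i : smooth_on U (fun p => p.2 0 i).
Proof.
have cc p : U p -> {for p, continuous (fun p : TRn => p.2 0 i)}.
  move=> _; apply: (@continuous_comp _ _ _ snd (fun y : 'rV[R]_n => y 0 i)).
    exact: cvg_snd.
  exact: coord_continuous.
case=> [|q]; split=> // v; split.
  by move=> p _; have [] := derive_snd_coord i p v.
apply: Ck_ext (Ck_cst q (v.2 0 i)) => p _.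
by rewrite (@derive_val _ _ _ _ _ _ _ (derive_snd_coord i p v)).
Qed.

Lemma smooth_det m (M : TRn -> 'M[R]_m) :
  (forall i j, smooth_on U (fun p => M p i j)) ->
  smooth_on U (fun p => \det (M p)).
Proof.
move=> sM; rewrite /determinant; apply: smooth_sum => s _.
by apply: smoothM; [exact: smooth_cst|apply: smooth_prod].
Qed.

(** Cramer's rule: cofactors divided by the determinant. *)
Lemma smooth_invmx m (M : TRn -> 'M[R]_m) i j :
  (forall i j, smooth_on U (fun p => M p i j)) ->
  (forall p, U p -> M p \in unitmx) ->
  smooth_on U (fun p => invmx (M p) i j).
Proof.
move=> sM uM.
apply: (@smooth_ext (fun p => (\det (M p))^-1 *
   ((-1) ^+ (j + i) * \det (row' j (col' i (M p)))))).
  by move=> p Up; rewrite /invmx uM // !mxE.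
apply: smoothM.
  by apply: smoothV; [move=> p /uM; rewrite unitmxE unitfE|exact: smooth_det].
apply: smoothM; first exact: smooth_cst.
apply: smooth_det => a b.
by apply: smooth_ext (sM (lift j a) (lift i b)) => p _; rewrite !mxE.
Qed.

Lemma smooth_dx k f : smooth_on U f -> smooth_on U (dx k f).
Proof. exact: smooth_derive. Qed.

Lemma smooth_dy k f : smooth_on U f -> smooth_on U (dy k f).
Proof. exact: smooth_derive. Qed.

Lemma smooth_dist f p (e : R) : smooth_on U f -> U p -> 0 < e ->
  \forall q \near p, `|f p - f q| < e.
Proof. by move=> sf Up; move/cvgrPdist_lt : (smooth_continuous sf Up); exact. Qed.

Lemma derive_dirD f p u v : smooth_on U f -> U p ->
  'D_(u + v) f p = 'D_u f p + 'D_v f p.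
Proof.
move=> sf Up; case: (@derive_add_dir R _ f p u v) => //.
- by apply: (near_open Up) => q Uq; exact: (@smooth_derivable f q v sf Uq).
- move=> e e0; exact: (smooth_dist (smooth_derive v sf) Up e0).
- exact: (@smooth_derivable f p u sf Up).
Qed.

Lemma derive_dirZ f p v (c : R) : smooth_on U f -> U p ->
  'D_(c *: v) f p = c * 'D_v f p.
Proof. by move=> sf Up; have [] := derive_scale_dir c (@smooth_derivable f p v sf Up). Qed.

Lemma derive_dir_sum f p (I : Type) (r : seq I) (v : I -> TRn) :
  smooth_on U f -> U p -> 'D_(\sum_(i <- r) v i) f p = \sum_(i <- r) 'D_(v i) f p.
Proof.
move=> sf Up; elim: r => [|i r IH]; first by rewrite !big_nil derive0.
by rewrite !big_cons derive_dirD // IH.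
Qed.

Lemma derive_fst f p (a : 'rV[R]_n) : smooth_on U f -> U p ->
  'D_(a, 0) f p = \sum_k a 0 k * dx k f p.
Proof.
move=> sf Up.
have -> : ((a, 0) : TRn) = \sum_k a 0 k *: ((delta_mx 0 k, 0) : TRn).
  apply/pair_eqP/andP; split; apply/eqP; rewrite raddf_sum /=.
    by rewrite {1}(row_sum_delta a).
  by rewrite big1 // => i _; rewrite scaler0.
by rewrite derive_dir_sum //; apply: eq_bigr => i _; rewrite derive_dirZ.
Qed.

Lemma derive_snd f p (b : 'rV[R]_n) : smooth_on U f -> U p ->
  'D_(0, b) f p = \sum_k b 0 k * dy k f p.
Proof.
move=> sf Up.
have -> : ((0, b) : TRn) = \sum_k b 0 k *: ((0, delta_mx 0 k) : TRn).
  apply/pair_eqP/andP; split; apply/eqP; rewrite raddf_sum /=.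
    by rewrite big1 // => i _; rewrite scaler0.
  by rewrite {1}(row_sum_delta b).
by rewrite derive_dir_sum //; apply: eq_bigr => i _; rewrite derive_dirZ.
Qed.

(** The last estimate of Schwarz's theorem: [x] and [y] are the mixed derivatives at the base point,
    [z] and [z'] those at the two intermediate points, equal up to the common factor [h * h]. *)
Lemma scaled_close (h e x y z z' : R) : 0 < h ->
  `|x - z| < e / 2 -> `|y - z'| < e / 2 -> h * (h * z') = h * (h * z) ->
  `|x - y| <= e.
Proof.
move=> h0 xz yz /(mulfI (lt0r_neq0 h0)) /(mulfI (lt0r_neq0 h0)) zz.
rewrite zz distrC in yz.
by rewrite (le_trans (ler_distD z x y)) // (splitr e) ltW // ltrD.
Qed.

(** Schwarz's theorem. The parallelogram is shrunk by [h] until it lies where both mixed derivatives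
    are within [e / 2] of their values at [p]. *)
Lemma deriveC f p u v : smooth_on U f -> U p ->
  'D_u ('D_v f) p = 'D_v ('D_u f) p.
Proof.
move=> sf Up.
have small (g : TRn -> R) (e : R) : 0 < e -> smooth_on U g ->
    exists2 d : R, 0 < d & forall q, `|p - q| < d -> U q /\ `|g p - g q| < e.
  move=> e0 sg.
  have : \forall q \near p, U q /\ `|g p - g q| < e.
    near=> q; split; first by near: q; exact: (near_open Up).
    by near: q; exact: (smooth_dist sg Up e0).
  move=> /nbhs_ballP[d /= d0 H]; exists d => // q pq; apply: H.
  by rewrite -ball_normE.
apply/eqP; rewrite -subr_eq0 -normr_le0; apply/ler_addgt0Pr => /= e e0.
rewrite add0r.
have e20 : 0 < e / 2 by rewrite divr_gt0.
have suv := smooth_derive u (smooth_derive v sf).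
have svu := smooth_derive v (smooth_derive u sf).
have [d1 d10 Huv] := small _ _ e20 suv.
have [d2 d20 Hvu] := small _ _ e20 svu.
pose d := Num.min d1 d2.
have d0 : 0 < d by rewrite lt_min d10 d20.
have dd1 : d <= d1 by rewrite ge_min lexx.
have dd2 : d <= d2 by rewrite ge_min lexx orbT.
have M0 : 0 < `|u| + `|v| + 1 by rewrite ltr_wpDl.
have [h h0 hd] : exists2 h : R, 0 < h & h * (`|u| + `|v| + 1) < d.
  exists (d / 2 / (`|u| + `|v| + 1)); first by rewrite !divr_gt0.
  by rewrite divfK ?gt_eqF// ltr_pdivrMr// ltr_pMr// ltr1n.
have K (s t : R) : s \in `[0, 1] -> t \in `[0, 1] ->
    `|p - (p + s *: (h *: u) + t *: (h *: v))| < d.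
  rewrite !in_itv /= => /andP[s0 s1] /andP[t0 t1].
  have hu : 0 <= h * `|u| by rewrite mulr_ge0 // ltW.
  have hv : 0 <= h * `|v| by rewrite mulr_ge0 // ltW.
  apply: le_lt_trans hd; rewrite -addrA opprD addNKr normrN.
  apply: (le_trans (ler_normD _ _)).
  rewrite !normrZ (ger0_norm s0) (ger0_norm t0) (ger0_norm (ltW h0)).
  rewrite !mulrDr mulr1; apply: ler_wpDr; first exact: ltW.
  by apply: lerD; exact: ler_piMl.
(* The sides are [h *: u] and [h *: v], so both mixed derivatives acquire the factor [h * h]. *)
have scale2 (a b : TRn) q : U q ->
    'D_(h *: a) ('D_(h *: b) f) q = h * (h * 'D_a ('D_b f) q).
  move=> Uq; apply: (etrans (@derive_dirZ _ q a h (smooth_derive (h *: b) sf) Uq)).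
  congr (_ * _); apply: (etrans (y := 'D_a (fun q => h * 'D_b f q) q)).
    by apply: near_eq_derive; apply: (near_open Uq) => q' Uq'; exact: derive_dirZ.
  exact: (@deriveMl R _ ('D_b f) h q a (smooth_derivable (smooth_derive b sf) Uq)).
have H : forall s t : R, s \in `[0, 1] -> t \in `[0, 1] ->
    [/\ derivable f (p + s *: (h *: u) + t *: (h *: v)) (h *: u),
        derivable f (p + s *: (h *: u) + t *: (h *: v)) (h *: v),
        derivable ('D_(h *: u) f) (p + s *: (h *: u) + t *: (h *: v)) (h *: v) &
        derivable ('D_(h *: v) f) (p + s *: (h *: u) + t *: (h *: v)) (h *: u)].
  move=> s t s01 t01; have Uq := (Huv _ (lt_le_trans (K s t s01 t01) dd1)).1.
  split; first exact: (smooth_derivable sf Uq).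
  - exact: (smooth_derivable sf Uq).
  - exact: (smooth_derivable (smooth_derive (h *: u) sf) Uq).
  - exact: (smooth_derivable (smooth_derive (h *: v) sf) Uq).
have [s [t [s' [t' [s01 t01 s01' t01' E]]]]] := schwarz_segment H.
have [U1 D1] := Hvu _ (lt_le_trans (K s t s01 t01) dd2).
have [U2 D2] := Huv _ (lt_le_trans (K s' t' s01' t01') dd1).
have E' := etrans (esym (scale2 v u _ U1)) (etrans E (scale2 u v _ U2)).
exact: (scaled_close h0 D2 D1 E').
Unshelve. all: by end_near. Qed.

End SmoothFunctions.

(** * Partial derivatives, homogeneous functions and Euler's identity *)

Section PartialDerivatives.
Context {R : realType} {n : nat}.
Local Opaque derive derivable.
Local Notation TRn := ('rV[R]_n * 'rV[R]_n)%type.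
Implicit Types (f g : TRn -> R) (p : TRn).
Variable U : set TRn.
Hypothesis oU : open U.

Lemma dy_eq k f g p : (forall q, U q -> f q = g q) -> U p -> dy k f p = dy k g p.
Proof. by move=> fg Up; apply: near_eq_derive; exact: (near_open oU Up fg). Qed.

Lemma dyD k f g p : smooth_on U f -> smooth_on U g -> U p ->
  dy k (fun q => f q + g q) p = dy k f p + dy k g p.
Proof.
move=> sf sg Up.
exact: (deriveD (smooth_derivable sf Up) (smooth_derivable sg Up)).
Qed.

Lemma dyB k f g p : smooth_on U f -> smooth_on U g -> U p ->
  dy k (fun q => f q - g q) p = dy k f p - dy k g p.
Proof.
move=> sf sg Up.
exact: (deriveB (smooth_derivable sf Up) (smooth_derivable sg Up)).
Qed.

Lemma dyM k f g p : smooth_on U f -> smooth_on U g -> U p ->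
  dy k (fun q => f q * g q) p = dy k f p * g p + f p * dy k g p.
Proof.
move=> sf sg Up; rewrite addrC [dy k f p * _]mulrC.
exact: (deriveM (smooth_derivable sf Up) (smooth_derivable sg Up)).
Qed.

Lemma dyMl k f p c : smooth_on U f -> U p ->
  dy k (fun q => c * f q) p = c * dy k f p.
Proof. by move=> sf Up; exact: (deriveMl _ (smooth_derivable sf Up)). Qed.

Lemma derive_sumE v (I : Type) (r : seq I) (f : I -> TRn -> R) p :
  (forall i, smooth_on U (f i)) -> U p ->
  'D_v (fun q => \sum_(i <- r) f i q) p = \sum_(i <- r) 'D_v (f i) p.
Proof.
move=> sf Up; elim: r => [|i r IH].
  rewrite big_nil (_ : (fun q => _) = cst 0) ?derive_cst//.
  by apply/funext => q; rewrite big_nil.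
rewrite big_cons -IH.
rewrite (_ : (fun q => _) = (fun q => f i q + \sum_(j <- r) f j q)); last first.
  by apply/funext => q; rewrite big_cons.
have ss := smooth_sum oU r (P := xpredT) (fun i _ => sf i).
exact: (deriveD (smooth_derivable (sf i) Up) (smooth_derivable ss Up)).
Qed.

Lemma dy_sum k (I : Type) (r : seq I) (f : I -> TRn -> R) p :
  (forall i, smooth_on U (f i)) -> U p ->
  dy k (fun q => \sum_(i <- r) f i q) p = \sum_(i <- r) dy k (f i) p.
Proof. exact: derive_sumE. Qed.

Lemma dy_coord k i p : dy k (fun q => q.2 0 i) p = (k == i)%:R.
Proof.
rewrite /dy (@derive_val _ _ _ _ _ _ _ (derive_snd_coord i p _)) /= mxE eqxx /=.
by rewrite eq_sym.
Qed.

Lemma dy_cst k c p : dy k (fun=> c) p = 0.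
Proof. exact: derive_cst. Qed.

Lemma dyC k l f p : smooth_on U f -> U p -> dy k (dy l f) p = dy l (dy k f) p.
Proof. exact: deriveC. Qed.

Lemma dxdyC k l f p : smooth_on U f -> U p -> dx k (dy l f) p = dy l (dx k f) p.
Proof. exact: deriveC. Qed.

Lemma dyN k f p : smooth_on U f -> U p -> dy k (fun q => - f q) p = - dy k f p.
Proof. by move=> sf Up; exact: (deriveN (smooth_derivable sf Up)). Qed.

(** The Leibniz rule, in which differentiating [y^h] isolates [w l]. Iterated, it differentiates an
    identity such as [W^i_h y^h = 0] as often as needed. *)
Lemma contraction_dy (w : 'I_n -> TRn -> R) g l p :
  (forall h, smooth_on U (w h)) -> smooth_on U g ->
  (forall q, U q -> \sum_h w h q * q.2 0 h = g q) -> U p ->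
  \sum_h dy l (w h) p * p.2 0 h = dy l g p - w l p.
Proof.
move=> sw sg wg Up.
have sy h := smooth_snd_coord oU h.
have swy h := smoothM oU (sw h) (sy h).
rewrite -(dy_eq l wg Up) (dy_sum l _ swy Up).
under [X in _ = X - _]eq_bigr => h _ do rewrite (dyM l (sw h) (sy h) Up) dy_coord.
rewrite big_split /=.
have -> : \sum_h w h p * (l == h)%:R = w l p.
  rewrite (bigD1 l) //= eqxx mulr1 big1 ?addr0 // => h hl.
  by rewrite eq_sym (negbTE hl) mulr0.
by rewrite addrK.
Qed.

End PartialDerivatives.

Section Homogeneous.
Context {R : realType} {n : nat}.
Local Opaque derive derivable.
Local Notation TRn := ('rV[R]_n * 'rV[R]_n)%type.
Implicit Types (f g : TRn -> R) (p : TRn).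
Variable D : set 'rV[R]_n.
Hypothesis oU : open (slit D).

(** Homogeneity for positive factors only, as for [F] itself. *)
Definition homog (d : nat) f : Prop := forall p a, slit D p -> 0 < a ->
  f (p.1, a *: p.2) = a ^+ d * f p.

Lemma slit_scale p (a : R) : slit D p -> 0 < a -> slit D (p.1, a *: p.2).
Proof. by move=> [Dp p0] a0; split=> //=; rewrite scaler_eq0 negb_or p0 gt_eqF. Qed.

Lemma homog_cst c : homog 0 (fun=> c).
Proof. by move=> p a _ _; rewrite mul1r. Qed.

Lemma homog_coord i : homog 1 (fun p => p.2 0 i).
Proof. by move=> p a _ _; rewrite mxE. Qed.

Lemma homogD d f g : homog d f -> homog d g -> homog d (fun p => f p + g p).
Proof. by move=> hf hg p a Up a0; rewrite hf// hg// mulrDr. Qed.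

Lemma homogB d f g : homog d f -> homog d g -> homog d (fun p => f p - g p).
Proof. by move=> hf hg p a Up a0; rewrite hf// hg// mulrBr. Qed.

Lemma homogM d e f g : homog d f -> homog e g -> homog (d + e) (fun p => f p * g p).
Proof. by move=> hf hg p a Up a0; rewrite hf// hg// exprD mulrACA. Qed.

Lemma homog_sum d (I : Type) (r : seq I) (f : I -> TRn -> R) :
  (forall i, homog d (f i)) -> homog d (fun p => \sum_(i <- r) f i p).
Proof.
by move=> hf p a Up a0; rewrite mulr_sumr; apply: eq_bigr => i _; rewrite hf.
Qed.

(** The fibre dilation keeps horizontal directions and multiplies vertical ones by [a]; this form
    serves [dx] and [dy] alike. *)
Lemma homog_derive d f v w p (a : R) : homog d f -> smooth_on (slit D) f ->
  slit D p -> 0 < a -> v = (w.1, a *: w.2) ->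
  'D_v f (p.1, a *: p.2) = a ^+ d * 'D_w f p.
Proof.
move=> hf sf Up a0 ->.
rewrite -(@derive_linear_map R _ _ (fun p : TRn => (p.1, a *: p.2))); last first.
  move=> b u x; apply/pair_eqP/andP; split; apply/eqP => //=.
  by rewrite scalerDr !scalerA mulrC.
rewrite -(deriveMl _ (smooth_derivable sf Up)); apply: near_eq_derive.
by apply: (near_open oU Up) => q Uq; exact: hf.
Qed.

Lemma homog_dx d k f : homog d f -> smooth_on (slit D) f -> homog d (dx k f).
Proof.
by move=> hf sf p a Up a0; apply: homog_derive => //=; rewrite scaler0.
Qed.

Lemma homog_dy d k f : homog d.+1 f -> smooth_on (slit D) f -> homog d (dy k f).
Proof.
move=> hf sf p a Up a0; apply: (@mulfI _ a); first by rewrite gt_eqF.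
apply: (etrans (esym (derive_dirZ _ _ sf (slit_scale Up a0)))).
rewrite mulrA -exprS; apply: homog_derive => //.
by apply/pair_eqP/andP; split; apply/eqP => //=; rewrite scaler0.
Qed.

(** Both sides are the derivative at [t = 1] of [f (x, t *: y) = t ^+ d * f (x, y)]. *)
Lemma euler d f p : homog d f -> smooth_on (slit D) f -> slit D p ->
  \sum_k dy k f p * p.2 0 k = d%:R * f p.
Proof.
move=> hf sf Up.
under eq_bigr do rewrite mulrC.
rewrite -(derive_snd oU _ sf Up).
(* The ray starts outside the slit bundle, but only its points near [t = 1] are used. *)
have ray (t : R) : (p.1, 0) + t *: (0, p.2) = (p.1, t *: p.2) :> TRn.
  by apply/pair_eqP/andP; split; apply/eqP => /=; rewrite ?scaler0 ?addr0 ?add0r.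
have ray1 : (p.1, 0) + 1 *: (0, p.2) = p :> TRn.
  by rewrite ray scale1r; case: (p).
have := @is_derive_line R _ f (p.1, 0) (0, p.2) 1.
rewrite ray1 => /(_ (smooth_derivable sf Up)) L.
rewrite -(@derive_val _ _ _ _ _ _ _ L).
rewrite (@near_eq_derive R _ _ _ (fun t : R => f p * t ^+ d)).
  rewrite (@deriveMl R _ (fun t : R => t ^+ d) (f p)).
    by rewrite exp_derive expr1n /GRing.scale /= !mulr1 mulrC.
  exact: exprn_derivable.
near=> t; rewrite ray hf 1?mulrC //.
by near: t; apply: lt_nbhsr; exact: ltr01.
Unshelve. all: by end_near. Qed.

End Homogeneous.

(* A copy of [dy] that conversion cannot unfold: comparing two distinct iterated
   derivatives would otherwise unfold them down to limits of filters. *)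
Definition pd_subproof (R : realType) (n : nat) :
  {g : 'I_n -> ('rV[R]_n * 'rV[R]_n -> R) -> 'rV[R]_n * 'rV[R]_n -> R | g = dy}.
Proof. by exists dy. Qed.

Definition pd {R : realType} {n : nat} := sval (pd_subproof R n).

Lemma pdE {R : realType} {n : nat} : pd = @dy R n.
Proof. exact: (svalP (pd_subproof R n)). Qed.

Section PartialDerivativeRules.
Context {R : realType} {n : nat}.
Local Notation TRn := ('rV[R]_n * 'rV[R]_n)%type.
Implicit Types (f g : TRn -> R) (p : TRn).
Variable U : set TRn.
Hypothesis oU : open U.

Lemma smooth_pd k f : smooth_on U f -> smooth_on U (pd k f).
Proof. by rewrite pdE; exact: smooth_dy. Qed.

Lemma pdC k l f p : smooth_on U f -> U p -> pd k (pd l f) p = pd l (pd k f) p.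
Proof. by rewrite !pdE; exact: dyC. Qed.

Lemma pd_eq k f g p : (forall q, U q -> f q = g q) -> U p -> pd k f p = pd k g p.
Proof. by rewrite !pdE; exact: dy_eq. Qed.

Lemma pdD k f g p : smooth_on U f -> smooth_on U g -> U p ->
  pd k (fun q => f q + g q) p = pd k f p + pd k g p.
Proof. by rewrite !pdE; exact: dyD. Qed.

Lemma pdN k f p : smooth_on U f -> U p -> pd k (fun q => - f q) p = - pd k f p.
Proof. by rewrite !pdE; exact: dyN. Qed.

Lemma pdB k f g p : smooth_on U f -> smooth_on U g -> U p ->
  pd k (fun q => f q - g q) p = pd k f p - pd k g p.
Proof. by rewrite !pdE; exact: dyB. Qed.

Lemma pdM k f g p : smooth_on U f -> smooth_on U g -> U p ->
  pd k (fun q => f q * g q) p = pd k f p * g p + f p * pd k g p.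
Proof. by rewrite !pdE; exact: dyM. Qed.

Lemma pdMl k f p c : smooth_on U f -> U p ->
  pd k (fun q => c * f q) p = c * pd k f p.
Proof. by rewrite !pdE; exact: dyMl. Qed.

Lemma pd_coord k i p : pd k (fun q : TRn => q.2 0 i) p = (k == i)%:R.
Proof. by rewrite !pdE; exact: dy_coord. Qed.

Lemma pd_cst k c p : pd k (fun=> c : R) p = 0.
Proof. by rewrite !pdE; exact: dy_cst. Qed.

Lemma pd_sum k (I : Type) (r : seq I) (f : I -> TRn -> R) p :
  (forall i, smooth_on U (f i)) -> U p ->
  pd k (fun q => \sum_(i <- r) f i q) p = \sum_(i <- r) pd k (f i) p.
Proof. by rewrite !pdE; exact: dy_sum. Qed.

Lemma contraction_pd (w : 'I_n -> TRn -> R) g l p :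
  (forall h, smooth_on U (w h)) -> smooth_on U g ->
  (forall q, U q -> \sum_h w h q * q.2 0 h = g q) -> U p ->
  \sum_h pd l (w h) p * p.2 0 h = pd l g p - w l p.
Proof. by rewrite !pdE; exact: contraction_dy. Qed.

End PartialDerivativeRules.

Section HomogeneousRules.
Context {R : realType} {n : nat}.
Local Notation TRn := ('rV[R]_n * 'rV[R]_n)%type.
Implicit Types (f g : TRn -> R) (p : TRn).
Variable D : set 'rV[R]_n.
Hypothesis oU : open (slit D).
Local Notation U := (slit D).

Lemma homog_pd d k f : homog D d.+1 f -> smooth_on U f -> homog D d (pd k f).
Proof. by rewrite pdE; exact: homog_dy. Qed.

Lemma euler_pd d f p : homog D d f -> smooth_on U f -> U p ->
  \sum_k pd k f p * p.2 0 k = d%:R * f p.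
Proof. by rewrite pdE; exact: euler. Qed.

(** In the first sum the three derivatives are moved past [y^h] one at a time, each leaving a term
    behind. The second sum vanishes by Euler's identity, second derivatives of [w l] being of degree
    [0]. *)
Lemma third_contraction (w : 'I_n -> TRn -> R) j k l p :
  (forall h, smooth_on U (w h)) -> (forall h, homog D 2 (w h)) ->
  (forall q, U q -> \sum_h w h q * q.2 0 h = 0) -> U p ->
  \sum_h (pd k (pd j (pd l (w h))) p - pd k (pd j (pd h (w l))) p) * p.2 0 h =
  - (pd j (pd k (w l)) p + pd l (pd j (w k)) p + pd k (pd l (w j)) p).
Proof.
move=> sw hw wy Up.
under eq_bigr do rewrite mulrBl.
rewrite sumrB.
have E1 q : U q -> \sum_h pd l (w h) q * q.2 0 h = - w l q.
  move=> Uq; rewrite (contraction_pd oU l sw (smooth_cst oU 0) wy Uq).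
  by rewrite pd_cst sub0r.
have sl h := smooth_pd l (sw h).
have E2 q : U q -> \sum_h pd j (pd l (w h)) q * q.2 0 h =
    - pd j (w l) q - pd l (w j) q.
  move=> Uq; rewrite (contraction_pd oU j sl (smoothN oU (sw l)) E1 Uq).
  by rewrite (pdN _ (sw l) Uq).
have sjl h := smooth_pd j (sl h).
have s1 := smooth_pd j (sw l); have s2 := smooth_pd l (sw j).
rewrite (contraction_pd oU k sjl (smoothB oU (smoothN oU s1) s2) E2 Up).
rewrite (pdB k (smoothN oU s1) s2 Up) (pdN k s1 Up).
have -> : \sum_h pd k (pd j (pd h (w l))) p * p.2 0 h = 0.
  have s3 := smooth_pd k (smooth_pd j (sw l)).
  have hl : homog D 0 (pd k (pd j (w l))) := homog_pd _ (homog_pd _ (hw l) (sw l)) s1.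
  have e0 := euler_pd hl s3 Up; rewrite mul0r in e0; rewrite -[RHS]e0.
  apply: eq_bigr => h _; congr (_ * _).
  rewrite (pdC oU h k s1 Up); apply: (pd_eq oU k _ Up) => q Uq.
  exact: (pdC oU j h (sw l) Uq).
rewrite subr0 (pdC oU k j (sw l) Up) (pdC oU l j (sw k) Up).
by rewrite !opprD -addrA [X in _ + X]addrC addrA.
Qed.

End HomogeneousRules.

(** * The spray, the Riemann curvature and the Weyl curvature *)

Section FinslerTensors.
Context {R : realType} {n : nat}.
Local Opaque derive derivable dx dy smooth_on.
Local Notation TRn := ('rV[R]_n * 'rV[R]_n)%type.
Implicit Types (f g : TRn -> R) (p : TRn).
Variables (D : set 'rV[R]_n) (F : TRn -> R).
Hypotheses (oU : open (slit D)) (finF : finsler_metric D F).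
Hypothesis n_gt1 : (1 < n)%N.

Local Notation U := (slit D).

Lemma smooth_sqF : smooth_on U (sqF F).
Proof. exact: (smoothX oU 2 (finsler_smooth finF)). Qed.

Lemma homog_sqF : homog D 2 (sqF F).
Proof.
move=> p a [Dp p0] a0; rewrite /sqF (finsler_homogeneous finF)// exprMn.
by case: (p).
Qed.

Lemma smooth_fundamental i j : smooth_on U (fun p => fundamental F p i j).
Proof.
have s := smooth_dy j (smooth_dy i smooth_sqF).
by apply: (smooth_ext oU) (smoothM oU (smooth_cst oU _) s) => p _; rewrite mxE.
Qed.

Lemma fundamental_scale p a : U p -> 0 < a ->
  fundamental F (p.1, a *: p.2) = fundamental F p.
Proof.
move=> Up a0; apply/matrixP => i j; rewrite [LHS]mxE [RHS]mxE.
have H : homog D 0 (dy j (dy i (sqF F))).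
  apply: (homog_dy oU); last exact: smooth_dy smooth_sqF.
  exact: (homog_dy oU _ homog_sqF smooth_sqF).
by rewrite H // mul1r.
Qed.

(** A nonzero row of the left kernel would be a null vector of a positive definite form. *)
Lemma unit_fundamental p : U p -> fundamental F p \in unitmx.
Proof.
move=> Up; rewrite -row_free_unit -kermx_eq0; apply/eqP/row_matrixP => i.
rewrite row0; apply/eqP; apply: contraT => u0.
have := finsler_posdef finF Up u0.
have /sub_kermxP -> : (row i (kermx (fundamental F p)) <= kermx (fundamental F p))%MS.
  exact: row_sub.
by rewrite mul0mx mxE ltxx.
Qed.

Lemma smooth_spray i : smooth_on U (spray F i).
Proof.
apply: (smoothM oU); first exact: smooth_cst.
apply: (smooth_sum oU) => l _; apply: (smoothM oU).
  exact: (smooth_invmx oU i l smooth_fundamental unit_fundamental).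
apply: (smoothB oU); last exact: smooth_dx smooth_sqF.
apply: (smooth_sum oU) => k _; apply: (smoothM oU); last exact: smooth_snd_coord.
exact: smooth_dy (smooth_dx k smooth_sqF).
Qed.

Lemma homog_spray i : homog D 2 (spray F i).
Proof.
apply: (@homogM _ _ _ 0 2) => [|]; first exact: homog_cst.
apply: homog_sum => l; apply: (@homogM _ _ _ 0 2).
  by move=> p a Up a0; rewrite fundamental_scale // mul1r.
have hx k := homog_dx oU k homog_sqF smooth_sqF.
apply: homogB; last exact: hx.
apply: homog_sum => k; apply: (@homogM _ _ _ 1 1); last exact: homog_coord.
exact: (homog_dy oU _ (hx k) (smooth_dx k smooth_sqF)).
Qed.

Lemma smooth_riemann i k : smooth_on U (riemann F i k).
Proof.
have sG := smooth_spray.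
apply: (smoothB oU).
  apply: (smoothD oU).
    apply: (smoothB oU).
      exact: (smoothM oU (smooth_cst oU _) (smooth_dx k (sG i))).
    apply: (smooth_sum oU) => m _.
    exact: (smoothM oU (smooth_dx m (smooth_dy k (sG i))) (smooth_snd_coord oU m)).
  apply: (smoothM oU (smooth_cst oU _)); apply: (smooth_sum oU) => m _.
  exact: (smoothM oU (sG m) (smooth_dy m (smooth_dy k (sG i)))).
apply: (smooth_sum oU) => m _.
exact: (smoothM oU (smooth_dy m (sG i)) (smooth_dy k (sG m))).
Qed.

Lemma homog_riemann i k : homog D 2 (riemann F i k).
Proof.
have sG := smooth_spray; have hG := homog_spray.
have hGy m l := homog_dy oU m (hG l) (sG l).
apply: homogB.
  apply: homogD.
    apply: homogB.
      apply: (@homogM _ _ _ 0 2); first exact: homog_cst.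
      exact: (homog_dx oU k (hG i) (sG i)).
    apply: homog_sum => m; apply: (@homogM _ _ _ 1 1); last exact: homog_coord.
    exact: (homog_dx oU m (hGy k i) (smooth_dy k (sG i))).
  apply: (@homogM _ _ _ 0 2); first exact: homog_cst.
  apply: homog_sum => m; apply: (@homogM _ _ _ 2 0); first exact: hG.
  exact: (homog_dy oU _ (hGy k i) (smooth_dy k (sG i))).
by apply: homog_sum => m; apply: (@homogM _ _ _ 1 1); exact: hGy.
Qed.

(** By Euler's identity the four terms cancel in pairs, the first against the second and the third
    against the fourth. *)
Lemma riemann_y i p : U p -> \sum_k riemann F i k p * p.2 0 k = 0.
Proof.
move=> Up; have sG := smooth_spray; have hG := homog_spray.
have E1 m : \sum_k dx m (dy k (spray F i)) p * p.2 0 k = 2 * dx m (spray F i) p.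
  under eq_bigr do rewrite (dxdyC oU _ _ (sG i) Up).
  exact: (euler oU (homog_dx oU m (hG i) (sG i)) (smooth_dx m (sG i)) Up).
have E2 m : \sum_k dy m (dy k (spray F i)) p * p.2 0 k = dy m (spray F i) p.
  under eq_bigr do rewrite (dyC oU _ _ (sG i) Up).
  have := euler oU (homog_dy oU m (hG i) (sG i)) (smooth_dy m (sG i)) Up.
  by rewrite mul1r.
have E3 m := euler oU (hG m) (sG m) Up.
under eq_bigr do rewrite /riemann mulrBl mulrDl mulrBl.
rewrite sumrB big_split /= sumrB.
have -> : \sum_k (\sum_m dx m (dy k (spray F i)) p * p.2 0 m) * p.2 0 k =
    \sum_m 2 * dx m (spray F i) p * p.2 0 m.
  under eq_bigr do rewrite mulr_suml.
  rewrite exchange_big /=; apply: eq_bigr => m _.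
  by rewrite -E1 mulr_suml; apply: eq_bigr => k _; rewrite mulrAC.
rewrite subrr add0r.
have -> : \sum_k 2 * (\sum_m spray F m p * dy m (dy k (spray F i)) p) * p.2 0 k =
    \sum_m 2 * (spray F m p * dy m (spray F i) p).
  rewrite -mulr_sumr.
  under eq_bigr do rewrite -mulrA mulr_suml.
  rewrite -mulr_sumr exchange_big /=; congr (_ * _); apply: eq_bigr => m _.
  by rewrite -E2 mulr_sumr; apply: eq_bigr => k _; rewrite mulrA.
have -> : \sum_k (\sum_m dy m (spray F i) p * dy k (spray F m) p) * p.2 0 k =
    \sum_m 2 * (spray F m p * dy m (spray F i) p).
  under eq_bigr do rewrite mulr_suml.
  rewrite exchange_big /=; apply: eq_bigr => m _.
  rewrite mulrA -E3 mulr_suml; apply: eq_bigr => k _.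
  by rewrite -mulrA [RHS]mulrC.
by rewrite subrr.
Qed.

Lemma smooth_ricci : smooth_on U (ricci_scalar F).
Proof.
apply: (smoothM oU (smooth_cst oU _)); apply: (smooth_sum oU) => m _.
exact: smooth_riemann.
Qed.

Lemma homog_ricci : homog D 2 (ricci_scalar F).
Proof.
apply: (@homogM _ _ _ 0 2); first exact: homog_cst.
by apply: homog_sum => m; exact: homog_riemann.
Qed.

Lemma smooth_weyl_aux i k : smooth_on U (weyl_aux F i k).
Proof.
apply: (smoothB oU); first exact: smooth_riemann.
exact: (smoothM oU smooth_ricci (smooth_cst oU _)).
Qed.

Lemma homog_weyl_aux i k : homog D 2 (weyl_aux F i k).
Proof.
apply: homogB; first exact: homog_riemann.
by apply: (@homogM _ _ _ 2 0); [exact: homog_ricci|exact: homog_cst].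
Qed.

Lemma weyl_aux_y i p : U p ->
  \sum_k weyl_aux F i k p * p.2 0 k = - (ricci_scalar F p * p.2 0 i).
Proof.
move=> Up; under eq_bigr do rewrite /weyl_aux mulrBl.
rewrite sumrB riemann_y // sub0r; congr (- _).
rewrite (bigD1 i) //= eqxx mulr1 big1 ?addr0 // => k ki.
by rewrite eq_sym (negbTE ki) mulr0 mul0r.
Qed.

Lemma weyl_aux_tr p : \sum_i weyl_aux F i i p = - ricci_scalar F p.
Proof.
under eq_bigr do rewrite /weyl_aux eqxx mulr1.
rewrite sumrB sumr_const card_ord.
have n1 : (n%:R - 1 : R) != 0.
  by rewrite subr_eq0 (eqr_nat R n 1); case: (n) n_gt1 => [|[]].
have -> : \sum_i riemann F i i p = (n%:R - 1) * ricci_scalar F p.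
  by rewrite /ricci_scalar mulVKf.
by rewrite -mulr_natl; ring.
Qed.

(** The divergence of [A y = - R y] is [- (n + 2) R] by Euler's identity; removing [tr A = - R]
    leaves [- (n + 1) R]. This is the origin of the constant [1 / (n + 1)] in the Weyl curvature. *)
Lemma weyl_aux_div p : U p ->
  \sum_k (\sum_m dy m (weyl_aux F m k) p) * p.2 0 k =
  - ((n%:R + 1) * ricci_scalar F p).
Proof.
move=> Up; under eq_bigr do rewrite mulr_suml.
rewrite exchange_big /=.
have sR := smooth_ricci; have sy h := smooth_snd_coord oU h.
have sg m := smoothM oU sR (sy m).
have E m := contraction_dy oU m (smooth_weyl_aux m)
  (smoothN oU (sg m)) (fun q => @weyl_aux_y m q) Up.
under eq_bigr do rewrite E (dyN _ (sg _) Up) (dyM _ sR (sy _) Up) dy_coord eqxx mulr1.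
rewrite sumrB weyl_aux_tr sumrN big_split /= (euler oU homog_ricci sR Up).
by rewrite sumr_const card_ord -mulr_natl; ring.
Qed.

Lemma smooth_weyl i k : smooth_on U (weyl F i k).
Proof.
apply: (smoothB oU); first exact: smooth_weyl_aux.
apply: (smoothM oU); last exact: smooth_snd_coord.
apply: (smoothM oU (smooth_cst oU _)); apply: (smooth_sum oU) => m _.
exact: smooth_dy (smooth_weyl_aux m k).
Qed.

Lemma homog_weyl i k : homog D 2 (weyl F i k).
Proof.
apply: homogB; first exact: homog_weyl_aux.
apply: (@homogM _ _ _ 1 1); last exact: homog_coord.
apply: (@homogM _ _ _ 0 1); first exact: homog_cst.
apply: homog_sum => m.
exact: (homog_dy oU _ (homog_weyl_aux m k) (smooth_weyl_aux m k)).
Qed.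

Lemma natr1_neq0 : (n%:R + 1 : R) != 0.
Proof. by rewrite natr1 pnatr_eq0. Qed.

Lemma weyl_y i p : U p -> \sum_k weyl F i k p * p.2 0 k = 0.
Proof.
move=> Up; under eq_bigr do rewrite /weyl mulrBl.
rewrite sumrB weyl_aux_y //.
under [X in _ - X]eq_bigr do rewrite mulrAC -[X in X * _]mulrA.
rewrite -mulr_suml -mulr_sumr weyl_aux_div // mulrN mulrA mulVf ?natr1_neq0 //.
by rewrite mul1r mulNr opprK addrC subrr.
Qed.

Lemma weyl_tr p : U p -> \sum_i weyl F i i p = 0.
Proof.
move=> Up; rewrite /weyl sumrB weyl_aux_tr.
under [X in _ - X]eq_bigr do rewrite -mulrA.
by rewrite -mulr_sumr weyl_aux_div // mulrN mulrA mulVf ?natr1_neq0 // mul1r opprK addrC subrr.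
Qed.

End FinslerTensors.

(** * The weakly-Weyl curvature in terms of derivatives of the Weyl curvature *)

Section WeaklyWeylCurvature.
Context {R : realType} {n : nat}.
Local Notation TRn := ('rV[R]_n * 'rV[R]_n)%type.
Implicit Types (f g : TRn -> R) (p : TRn).
Variables (D : set 'rV[R]_n) (F : TRn -> R).
Hypotheses (oU : open (slit D)) (finF : finsler_metric D F).
Hypothesis n_gt1 : (1 < n)%N.

Local Notation U := (slit D).

Lemma dy_weyl4 j i h l k p : U p ->
  dy k (weyl4 F j i h l) p =
  3^-1 * (dy k (dy j (dy l (weyl F i h))) p - dy k (dy j (dy h (weyl F i l))) p).
Proof.
move=> Up; have sW := smooth_weyl oU finF.
have s1 := smooth_dy l (sW i h); have s2 := smooth_dy h (sW i l).
have s11 := smooth_dy j s1; have s22 := smooth_dy j s2.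
rewrite (@dy_eq _ _ _ oU k _
  (fun q => 3^-1 * (dy j (dy l (weyl F i h)) q - dy j (dy h (weyl F i l)) q)) p) //.
  by rewrite (dyMl _ _ (smoothB oU s11 s22) Up) (dyB _ s11 s22 Up).
move=> q Uq.
by rewrite /weyl4 (dyMl _ _ (smoothB oU s1 s2) Uq) (dyB _ s1 s2 Uq).
Qed.

(** Before the contraction is evaluated, the formula shows that the curvature vanishes as soon as
    the third derivatives of [W] do. *)
Lemma weakly_weyl_curv_third j i k l p : U p ->
  weakly_weyl_curv F j i k l p = 3^-1 *
   \sum_h (pd k (pd j (pd l (weyl F i h))) p - pd k (pd j (pd h (weyl F i l))) p) * p.2 0 h.
Proof.
move=> Up; rewrite !pdE mulr_sumr /weakly_weyl_curv; apply: eq_bigr => h _.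
by rewrite mulrA dy_weyl4.
Qed.

Lemma weakly_weyl_curvE j i k l p : U p ->
  weakly_weyl_curv F j i k l p =
  - (3^-1 * (pd j (pd k (weyl F i l)) p + pd l (pd j (weyl F i k)) p +
             pd k (pd l (weyl F i j)) p)).
Proof.
move=> Up; rewrite weakly_weyl_curv_third //.
rewrite (third_contraction oU j k l (smooth_weyl oU finF i) (homog_weyl oU finF i)
  (weyl_y oU finF n_gt1 i) Up).
by rewrite mulrN.
Qed.

End WeaklyWeylCurvature.

(** * Equivariance under orthogonal maps *)

Section Equivariance.
Context {R : realType} {n : nat}.
Local Notation TRn := ('rV[R]_n * 'rV[R]_n)%type.
Implicit Types (f g : TRn -> R) (p : TRn).
Variables (D : set 'rV[R]_n) (F : TRn -> R) (A : 'M[R]_n).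
Hypotheses (oU : open (slit D)) (finF : finsler_metric D F).
Hypothesis orthA : A *m A^T = 1%:M.
Hypothesis DA : forall x, D x -> D (x *m A).
Hypothesis FA : forall x y, D x -> F (x *m A, y *m A) = F (x, y).

Local Notation U := (slit D).
Local Notation act p := ((p.1 *m A, p.2 *m A) : TRn).

(** For orthogonal [A] upper and lower indices transform alike, so the transformation laws become
    [c *m A] for rows and [A^T *m T *m A] for matrices. *)
Definition row_of (c : 'I_n -> TRn -> R) p : 'rV[R]_n := \row_k c k p.
Definition mx_of (T : 'I_n -> 'I_n -> TRn -> R) p : 'M[R]_n := \matrix_(i, k) T i k p.

Lemma orthA' : A^T *m A = 1%:M.
Proof. exact: mulmx1C. Qed.

Lemma slit_act p : U p -> U (act p).
Proof.
move=> [Dp p0]; split => /=; first exact: DA.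
apply: contra_neq p0 => yA; rewrite -[p.2]mulmx1 -orthA mulmxA.
by move: yA => /= ->; rewrite mul0mx.
Qed.

(** Here [g] is the transformation law of [f], in general a combination of several components;
    invariance is the case [g = f]. *)
Lemma derive_act f g (w : TRn) p : (forall q, U q -> f (act q) = g q) -> U p ->
  'D_(act w) f (act p) = 'D_w g p.
Proof.
move=> fg Up.
apply: (etrans (esym (@derive_linear_map R _ _ (fun q : TRn => act q) f p _ _))).
  move=> a u x; apply/pair_eqP/andP; split; apply/eqP => /=;
  by rewrite mulmxDl scalemxAl.
by apply: near_eq_derive; exact: (near_open oU Up fg).
Qed.

Lemma act_fst k : act ((delta_mx 0 k *m A^T, 0) : TRn) = (delta_mx 0 k, 0).
Proof. by rewrite /= -mulmxA orthA' mulmx1 mul0mx. Qed.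

Lemma act_snd k : act ((0, delta_mx 0 k *m A^T) : TRn) = (0, delta_mx 0 k).
Proof. by rewrite /= -mulmxA orthA' mulmx1 mul0mx. Qed.

Lemma dx_act f g k p : (forall q, U q -> f (act q) = g q) -> smooth_on U g ->
  U p -> dx k f (act p) = \sum_j dx j g p * A j k.
Proof.
move=> fg sg Up; rewrite /dx -act_fst (derive_act _ fg Up).
apply: (etrans (derive_fst oU _ sg Up)).
by apply: eq_bigr => j _; rewrite mulrC -rowE !mxE.
Qed.

Lemma dy_act f g k p : (forall q, U q -> f (act q) = g q) -> smooth_on U g ->
  U p -> dy k f (act p) = \sum_j dy j g p * A j k.
Proof.
move=> fg sg Up; rewrite /dy -act_snd (derive_act _ fg Up).
apply: (etrans (derive_snd oU _ sg Up)).
by apply: eq_bigr => j _; rewrite mulrC -rowE !mxE.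
Qed.

Lemma row_act_dx f p : (forall q, U q -> f (act q) = f q) -> smooth_on U f ->
  U p -> row_of (fun k => dx k f) (act p) = row_of (fun k => dx k f) p *m A.
Proof.
move=> fA sf Up; apply/rowP => k; rewrite [LHS]mxE [RHS]mxE (dx_act _ fA) //.
by apply: eq_bigr => j _; rewrite mxE.
Qed.

Lemma row_act_dy f p : (forall q, U q -> f (act q) = f q) -> smooth_on U f ->
  U p -> row_of (fun k => dy k f) (act p) = row_of (fun k => dy k f) p *m A.
Proof.
move=> fA sf Up; apply/rowP => k; rewrite [LHS]mxE [RHS]mxE (dy_act _ fA) //.
by apply: eq_bigr => j _; rewrite mxE.
Qed.

Lemma row_actE (c : 'I_n -> TRn -> R) i p :
  row_of c (act p) = row_of c p *m A -> c i (act p) = \sum_a A a i * c a p.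
Proof.
move=> /rowP/(_ i); rewrite !mxE => ->.
by apply: eq_bigr => a _; rewrite mxE mulrC.
Qed.

Lemma mx_actE (T : 'I_n -> 'I_n -> TRn -> R) i k p :
  mx_of T (act p) = A^T *m mx_of T p *m A ->
  T i k (act p) = \sum_b \sum_a A a i * A b k * T a b p.
Proof.
move=> /matrixP/(_ i k); rewrite !mxE => ->.
apply: eq_bigr => b _; rewrite mxE mulr_suml; apply: eq_bigr => a _.
by rewrite !mxE mulrAC.
Qed.

Section Jacobians.
Variable c : 'I_n -> TRn -> R.
Hypothesis sc : forall i, smooth_on U (c i).
Hypothesis cA : forall p, U p -> row_of c (act p) = row_of c p *m A.

Let cA_ext i q (Uq : U q) := row_actE i (cA Uq).

Let smooth_cA i : smooth_on U (fun q => \sum_a A a i * c a q).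
Proof. by apply: (smooth_sum oU) => a _; exact: (smoothM oU (smooth_cst oU _) (sc a)). Qed.

Lemma mx_act_dy p : U p ->
  mx_of (fun i k => dy k (c i)) (act p) =
  A^T *m mx_of (fun i k => dy k (c i)) p *m A.
Proof.
move=> Up; apply/matrixP => i k; rewrite [LHS]mxE [RHS]mxE.
rewrite (dy_act k (cA_ext i) (smooth_cA i) Up); apply: eq_bigr => j _.
congr (_ * _); rewrite [RHS]mxE.
rewrite (dy_sum oU _ _ (fun a => smoothM oU (smooth_cst oU (A a i)) (sc a)) Up).
by apply: eq_bigr => a _; rewrite (dyMl _ _ (sc a) Up) !mxE.
Qed.

Lemma mx_act_dx p : U p ->
  mx_of (fun i k => dx k (c i)) (act p) =
  A^T *m mx_of (fun i k => dx k (c i)) p *m A.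
Proof.
move=> Up; apply/matrixP => i k; rewrite [LHS]mxE [RHS]mxE.
rewrite (dx_act k (cA_ext i) (smooth_cA i) Up); apply: eq_bigr => j _.
congr (_ * _); rewrite [RHS]mxE.
apply: (etrans (derive_sumE oU _ _ (fun a => smoothM oU (smooth_cst oU (A a i)) (sc a)) Up)).
apply: eq_bigr => a _; rewrite [X in _ = X * _]mxE [X in _ = _ * X]mxE.
exact: (deriveMl _ (smooth_derivable (sc a) Up)).
Qed.

End Jacobians.

Section Derivatives.
Variable T : 'I_n -> 'I_n -> TRn -> R.
Hypothesis sT : forall i k, smooth_on U (T i k).
Hypothesis TA : forall p, U p -> mx_of T (act p) = A^T *m mx_of T p *m A.

(** The direction is arbitrary because the Riemann curvature differentiates along the vectors [y]
    and [G], which move with the point. *)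
Lemma mx_act_derive (w : TRn) p : U p ->
  (\matrix_(i, k) 'D_(act w) (T i k) (act p) : 'M[R]_n) =
  A^T *m (\matrix_(i, k) 'D_w (T i k) p) *m A.
Proof.
move=> Up; apply/matrixP => i k; rewrite [LHS]mxE [RHS]mxE.
have fg q (Uq : U q) := mx_actE i k (TA Uq).
apply: (etrans (derive_act w fg Up)).
have st a b := smoothM oU (smooth_cst oU (A a i * A b k)) (sT a b).
apply: (etrans (derive_sumE oU _ _ (fun b => smooth_sum oU _ (fun a _ => st a b)) Up)).
apply: eq_bigr => b _; rewrite [X in _ = X * _]mxE mulr_suml.
apply: (etrans (derive_sumE oU _ _ (fun a => st a b) Up)).
apply: eq_bigr => a _; rewrite [X in _ = X * _ * _]mxE [X in _ = _ * X * _]mxE mulrAC.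
exact: (deriveMl _ (smooth_derivable (sT a b) Up)).
Qed.

Lemma row_act_div p : U p ->
  row_of (fun k q => \sum_m dy m (T m k) q) (act p) =
  row_of (fun k q => \sum_m dy m (T m k) q) p *m A.
Proof.
move=> Up; apply/rowP => k; rewrite [LHS]mxE [RHS]mxE.
pose T' c : 'M[R]_n := \matrix_(a, b) dy c (T a b) p.
have E m : dy m (T m k) (act p) = \sum_c A c m * (A^T *m T' c *m A) m k.
  have := mx_act_derive (0, delta_mx 0 m *m A^T) Up.
  rewrite act_snd => /matrixP/(_ m k); rewrite [LHS]mxE => E; apply: (etrans E) => {E}.
  have -> : (\matrix_(i, j) 'D_((0, delta_mx 0 m *m A^T) : TRn) (T i j) p : 'M[R]_n) =
     \sum_c A c m *: T' c.
    apply/matrixP => a b; rewrite [LHS]mxE summxE.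
    apply: (etrans (derive_snd oU _ (sT a b) Up)).
    by apply: eq_bigr => c _; rewrite [RHS]mxE [X in _ = _ * X]mxE -rowE !mxE.
  rewrite mulmx_sumr mulmx_suml summxE; apply: eq_bigr => c _.
  by rewrite -scalemxAr -scalemxAl mxE.
transitivity (\sum_m \sum_c A c m * (A^T *m T' c *m A) m k).
  by apply: eq_bigr => m _; exact: E.
transitivity (\sum_c \sum_m A c m * (A^T *m T' c *m A) m k); first exact: exchange_big.
(* The factor [A] of the differentiation index meets the [A^T] of the upper index and cancels. *)
transitivity (\sum_c (T' c *m A) c k).
  apply: eq_bigr => c _; rewrite -[T' c in RHS]mul1mx -orthA -!mulmxA [RHS]mxE.
  by rewrite !mulmxA.
under eq_bigr do rewrite mxE.
rewrite exchange_big /=; apply: eq_bigr => b _.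
by rewrite -mulr_suml [in RHS]mxE; congr (_ * _); apply: eq_bigr => c _; rewrite mxE.
Qed.

End Derivatives.

Lemma sqF_act q : U q -> sqF F (act q) = sqF F q.
Proof. by move=> [Dq _]; rewrite /sqF /= FA //; case: (q). Qed.

Let sF := smooth_sqF oU finF.

Lemma fundamental_act p : U p -> fundamental F (act p) = A^T *m fundamental F p *m A.
Proof.
move=> Up.
have E q : fundamental F q = 2^-1 *: mx_of (fun i k => dy k (dy i (sqF F))) q.
  by apply/matrixP => i j; rewrite [LHS]mxE [RHS]mxE [X in _ = _ * X]mxE.
rewrite !E (mx_act_dy (fun i => smooth_dy i sF) (fun q => row_act_dy sqF_act sF) Up).
by rewrite -scalemxAr -scalemxAl.
Qed.

Lemma invmx_act M : M \in unitmx -> invmx (A^T *m M *m A) = A^T *m invmx M *m A.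
Proof.
move=> uM.
have H : (A^T *m M *m A) *m (A^T *m invmx M *m A) = 1%:M.
  by rewrite !mulmxA -(mulmxA _ A A^T) orthA mulmx1 mulmxK // orthA'.
have [uP _] := mulmx1_unit H.
by rewrite -[RHS]mul1mx -(mulVmx uP) -[RHS]mulmxA H mulmx1.
Qed.

Lemma row_sprayE p : row_of (spray F) p =
  4^-1 *: ((p.2 *m mx_of (fun k l => dy l (dx k (sqF F))) p -
            row_of (fun l => dx l (sqF F)) p) *m (invmx (fundamental F p))^T).
Proof.
apply/rowP => i; rewrite [LHS]mxE [RHS]mxE [X in _ = _ * X]mxE; congr (_ * _).
apply: eq_bigr => l _; rewrite [X in _ = _ * X]mxE mulrC; congr (_ * _).
rewrite [RHS]mxE [X in _ = X + _]mxE [X in _ = _ + X]mxE [X in _ = _ - X]mxE.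
by congr (_ - _); apply: eq_bigr => k _; rewrite [X in _ = _ * X]mxE mulrC.
Qed.

Lemma row_act_spray p : U p -> row_of (spray F) (act p) = row_of (spray F) p *m A.
Proof.
move=> Up; rewrite !row_sprayE fundamental_act // invmx_act; last exact: (unit_fundamental finF).
rewrite (mx_act_dy (fun i => smooth_dx i sF) (fun q => row_act_dx sqF_act sF) Up).
rewrite (row_act_dx sqF_act sF Up) /= -scalemxAl; congr (_ *: _).
rewrite !mulmxA -(mulmxA p.2) orthA mulmx1 -mulmxBl.
by rewrite !trmx_mul trmxK !mulmxA -(mulmxA _ A A^T) orthA mulmx1.
Qed.

(** The sums against [y^m] and [G^m] are read as derivatives along [(y, 0)] and [(0, G)], to which
    [mx_act_derive] applies. *)
Lemma mx_riemannE p : U p -> mx_of (riemann F) p =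
  2 *: mx_of (fun i k => dx k (spray F i)) p
  - \matrix_(i, k) 'D_((p.2, 0) : TRn) (dy k (spray F i)) p
  + 2 *: \matrix_(i, k) 'D_((0, row_of (spray F) p) : TRn) (dy k (spray F i)) p
  - mx_of (fun i k => dy k (spray F i)) p *m mx_of (fun i k => dy k (spray F i)) p.
Proof.
move=> Up; have sGy i k := smooth_dy k (smooth_spray oU finF i).
apply/matrixP => i k; rewrite [LHS]mxE.
have -> : forall M1 M2 M3 M4 : 'M[R]_n, (2 *: M1 - M2 + 2 *: M3 - M4) i k =
   2 * M1 i k - M2 i k + 2 * M3 i k - M4 i k by move=> *; rewrite !mxE.
congr (_ - _ + 2 * _ - _).
- by rewrite [X in _ = _ * X]mxE.
- rewrite [RHS]mxE; apply: (etrans _ (esym (derive_fst oU _ (sGy i k) Up))).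
  by apply: eq_bigr => m _; exact: mulrC.
- rewrite [RHS]mxE; apply: (etrans _ (esym (derive_snd oU _ (sGy i k) Up))).
  by apply: eq_bigr => m _; rewrite [X in _ = X * _]mxE.
- rewrite [RHS]mxE; apply: eq_bigr => m _.
  by rewrite [X in _ = X * _]mxE [X in _ = _ * X]mxE.
Qed.

Lemma conj_combination (M1 M2 M3 M4 N1 N2 N3 N4 : 'M[R]_n) :
  M1 = A^T *m N1 *m A -> M2 = A^T *m N2 *m A -> M3 = A^T *m N3 *m A ->
  M4 = A^T *m N4 *m A ->
  2 *: M1 - M2 + 2 *: M3 - M4 *m M4 =
  A^T *m (2 *: N1 - N2 + 2 *: N3 - N4 *m N4) *m A.
Proof.
move=> -> -> -> ->.
rewrite !(mulmxDr, mulmxN) !(mulmxDl, mulNmx) -!scalemxAr -!scalemxAl.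
have -> : A^T *m N4 *m A *m (A^T *m N4 *m A) = A^T *m (N4 *m N4) *m A; last by [].
by rewrite !mulmxA -(mulmxA _ A A^T) orthA mulmx1.
Qed.

Lemma mx_act_riemann p : U p ->
  mx_of (riemann F) (act p) = A^T *m mx_of (riemann F) p *m A.
Proof.
move=> Up; have Uap := slit_act Up.
have sG := smooth_spray oU finF.
have GA := row_act_spray.
have sGy i k := smooth_dy k (sG i).
have GyA := mx_act_dy sG GA.
have E1 := mx_act_dx sG GA Up.
have E2 := GyA p Up.
have E3 := mx_act_derive sGy GyA (p.2, 0) Up.
have E4 := mx_act_derive sGy GyA (0, row_of (spray F) p) Up.
rewrite /= mul0mx in E3; rewrite /= mul0mx -(GA p Up) in E4.
apply: (etrans (mx_riemannE Uap)).
apply: (etrans _ (esym (congr1 (fun M => A^T *m M *m A) (mx_riemannE Up)))).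
exact: (conj_combination E1 E3 E4 E2).
Qed.

Lemma ricci_act p : U p -> ricci_scalar F (act p) = ricci_scalar F p.
Proof.
move=> Up.
have E q : ricci_scalar F q = (n%:R - 1)^-1 * \tr (mx_of (riemann F) q).
  by congr (_ * _); apply: eq_bigr => m _; rewrite mxE.
have tr_conj (M : 'M[R]_n) : \tr (A^T *m M *m A) = \tr M.
  by rewrite mxtrace_mulC mulmxA orthA mul1mx.
by rewrite (E (act p)) mx_act_riemann // tr_conj -E.
Qed.

Lemma mx_act_weyl_aux p : U p ->
  mx_of (weyl_aux F) (act p) = A^T *m mx_of (weyl_aux F) p *m A.
Proof.
move=> Up.
have E q : mx_of (weyl_aux F) q = mx_of (riemann F) q - (ricci_scalar F q)%:M.
  by apply/matrixP => i k; rewrite [LHS]mxE [RHS]mxE !mxE -mulr_natr.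
rewrite !E mx_act_riemann // ricci_act // mulmxBr mulmxBl; congr (_ - _).
by rewrite mul_mx_scalar -scalemxAl orthA' scalemx1.
Qed.

Lemma mx_act_weyl p : U p ->
  mx_of (weyl F) (act p) = A^T *m mx_of (weyl F) p *m A.
Proof.
move=> Up.
have E q : mx_of (weyl F) q = mx_of (weyl_aux F) q - (n%:R + 1)^-1 *:
    (q.2^T *m row_of (fun k q => \sum_m dy m (weyl_aux F m k) q) q).
  apply/matrixP => i k; rewrite [LHS]mxE [RHS]mxE [X in _ = X + _]mxE.
  rewrite [X in _ = _ + X]mxE [X in _ = _ - X]mxE [X in _ = _ - _ * X]mxE big_ord1.
  by rewrite [X in _ = _ - _ * (X * _)]mxE [X in _ = _ - _ * (_ * X)]mxE /weyl -mulrA (mulrC _ (q.2 0 i)).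
have sA := smooth_weyl_aux oU finF.
rewrite !E mx_act_weyl_aux // (row_act_div sA mx_act_weyl_aux Up) /=.
rewrite mulmxBr mulmxBl; congr (_ - _).
by rewrite -scalemxAr -scalemxAl trmx_mul !mulmxA.
Qed.

End Equivariance.

(** * Functions on a fibre of the tangent bundle *)

Section IndexAlgebra.
Context {R : realFieldType} {I : eqType}.

(* The instances of the cyclic identity for four indices say that any three of the
   four values of [T], told apart by their last index, add up to zero. *)
Lemma sym_cyclic_eq0 (T : I -> I -> I -> I -> R) :
  (forall a b c d, T a b c d = T b a c d) ->
  (forall a b c d, T a b c d = T a c b d) ->
  (forall a b c d, T a b c d + T a d b c + T a c d b = 0) ->
  forall a b c d, T a b c d = 0.
Proof.
move=> s12 s23 cyc a b c d.
have := cyc a b c d; rewrite (s23 a d b c).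
have := cyc b a c d; rewrite (s12 b a c d) (s23 b d a c) (s12 b a d c).
have := cyc c a b d.
rewrite (s12 c a b d) (s23 a c b d) (s23 c d a b) (s12 c a d b) (s12 c b d a).
have := cyc d a b c.
rewrite (s12 d a b c) (s23 a d b c) (s23 d c a b) (s12 d a c b) (s23 a d c b).
rewrite (s12 d b c a) (s23 b d c a).
lra.
Qed.

(** The index argument behind the uniqueness of the Levi-Civita connection. *)
Lemma sym_antisym_eq0 (T : I -> I -> I -> R) :
  (forall a b c, T a b c = T b a c) -> (forall a b c, T a b c + T a c b = 0) ->
  forall a b c, T a b c = 0.
Proof.
move=> s anti a b c.
have := anti a b c; have := anti b c a; have := anti c a b.
by rewrite (s b a c) (s c b a) (s c a b); lra.
Qed.

(** Combining the components [p1] and [p2] eliminates [Om] and says that the symmetric product of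
    [h] with the covector [e] is zero. As [e p1 != 0], this kills first [h p1 p1], then the row
    [p1], then all of [h]. *)
Lemma sym_rank_one_eq0 (o p1 p2 : I) (h : I -> I -> R) (y : I -> R)
    (Om : I -> I -> I -> R) :
  p1 != p2 -> p1 != o -> p2 != o -> y p1 != 0 -> y p2 != 0 ->
  (forall j k, h j k = h k j) ->
  (forall i j k l, i != o ->
     (i == l)%:R * h j k + (i == j)%:R * h k l + (i == k)%:R * h j l = Om j k l * y i) ->
  (forall j k, h j k = 0) /\ forall j k l, Om j k l = 0.
Proof.
move=> p12 p1o p2o y1 y2 hs H.
pose e l : R := y p2 * (p1 == l)%:R - y p1 * (p2 == l)%:R.
have E j k l : e l * h j k + e j * h k l + e k * h j l = 0.
  have := congr1 (fun z => y p2 * z) (H p1 j k l p1o).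
  have := congr1 (fun z => y p1 * z) (H p2 j k l p2o).
  by rewrite /e; lra.
have e1 : e p1 != 0 by rewrite /e eqxx (eq_sym p2) (negbTE p12) mulr1 mulr0 subr0.
have h11 : h p1 p1 = 0.
  have := E p1 p1 p1; rewrite -!mulrDl => /eqP; rewrite mulf_eq0 => /orP[|/eqP//].
  by move=> /eqP e30; move: e1; rewrite (_ : e p1 = 0) ?eqxx//; lra.
have h1 l : h p1 l = 0.
  have := E p1 p1 l; rewrite h11 mulr0 add0r -mulrDl => /eqP; rewrite mulf_eq0.
  by move=> /orP[|/eqP//] /eqP e30; move: e1; rewrite (_ : e p1 = 0) ?eqxx//; lra.
have h0 j k : h j k = 0.
  have := E j k p1; rewrite (hs k p1) (hs j p1) !h1 !mulr0 !addr0 => /eqP.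
  by rewrite mulf_eq0 (negbTE e1) => /eqP.
split=> // j k l; have := H p1 j k l p1o; rewrite !h0 !mulr0 !addr0 => /esym/eqP.
by rewrite mulf_eq0 (negbTE y1) orbF => /eqP.
Qed.

(* [y_q e_p - y_p e_q] being an eigenvector of [W] and of its transpose, for all
   [p, q] other than [o], leaves only multiples of the identity, of [y^T eta], and
   an arbitrary row [o]. *)
Lemma reflection_structure (o p1 p2 : I) (W : I -> I -> R) (y : I -> R) :
  p1 != p2 -> p1 != o -> p2 != o -> (forall i, i != o -> y i != 0) ->
  (forall p q k, p != q -> p != o -> q != o -> k != p -> k != q ->
     y q * W p k = y p * W q k) ->
  (forall p q, p != q -> p != o -> q != o ->
     y q * (y q * W p q - y p * W q q) + y p * (y q * W p p - y p * W q p) = 0) ->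
  let eta k := if k == p1 then W p2 p1 * (y p2)^-1 else W p1 k * (y p1)^-1 in
  let a := W p1 p1 - eta p1 * y p1 in
  forall i k, W i k = (i == k)%:R * a + eta k * y i +
    (i == o)%:R * (W o k - (o == k)%:R * a - eta k * y o).
Proof.
move=> p12 p1o p2o y0 Ha Hb eta a i k.
have [->|io] := eqVneq i o; first by rewrite mul1r; ring.
rewrite mul0r addr0.
have y1 := y0 _ p1o; have y2 := y0 _ p2o; have yi := y0 _ io.
have W1 : W i p1 = (i == p1)%:R * a + eta p1 * y i.
  have [->|ip1] := eqVneq i p1; first by rewrite /a mul1r; ring.
  rewrite mul0r add0r /eta eqxx.
  have [->|ip2] := eqVneq i p2; first by rewrite mulfVK.
  have := Ha p2 i p1; rewrite eq_sym ip2 => /(_ isT p2o io p12).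
  by rewrite eq_sym ip1 => /(_ isT) E; apply: (mulfI y2); rewrite -E; field.
have [kp1|kp1] := eqVneq k p1; first by rewrite kp1.
have [ip1|ip1] := eqVneq i p1.
  by rewrite ip1 eq_sym (negbTE kp1) mul0r add0r /eta (negbTE kp1) mulfVK.
have [ik|ik] := eqVneq i k.
  rewrite -ik mul1r /a /eta eqxx (negbTE ip1).
  have := Hb p1 i; rewrite eq_sym ip1 W1 (negbTE ip1) mul0r add0r /eta eqxx.
  move=> /(_ isT p1o io) E.
  (* After multiplication by [y p1 * y i] the difference becomes minus the left side of [E]. *)
  suff : (W i i - (W p1 p1 - W p2 p1 / y p2 * y p1 + W p1 i / y p1 * y i)) * (y p1 * y i) = 0.
    by move=> /eqP; rewrite !mulf_eq0 (negbTE y1) (negbTE yi) !orbF subr_eq0 => /eqP.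
  transitivity (- (y i * (y i * W p1 i - y p1 * W i i) +
    y p1 * (y i * W p1 p1 - y p1 * (W p2 p1 / y p2 * y i)))).
    by field; rewrite y1 y2.
  by rewrite E oppr0.
rewrite mul0r add0r /eta (negbTE kp1).
have E : y i * W p1 k = y p1 * W i k by apply: Ha => //; rewrite eq_sym.
by apply: (@mulfI _ (y p1)) => //; rewrite -E; field.
Qed.

End IndexAlgebra.

Section Fibres.
Context {R : realType} {n : nat}.
Local Notation TRn := ('rV[R]_n * 'rV[R]_n)%type.
Implicit Types (f g : TRn -> R).

Lemma dy_fibre k f x y : dy k f (x, y) = 'D_(delta_mx 0 k) (fun z => f (x, z)) y.
Proof.
rewrite /dy /derive.
suff -> : (fun h : R => h^-1 *: ((f \o shift (x, y)) (h *: ((0, delta_mx 0 k) : TRn)) - f (x, y))) =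
  (fun h : R => h^-1 *: (((fun z => f (x, z)) \o shift y) (h *: delta_mx 0 k) - f (x, y))) by [].
apply/funext => h /=; congr (_ *: (f _ - _)).
by apply/pair_eqP/andP; split; apply/eqP => //=; rewrite scaler0 add0r.
Qed.

(** Vertical derivatives see only the fibre over [x]. The normal form of [W] is available over a
    single axis point, not on an open set of the bundle, so [pd_eq] cannot differentiate it. *)
Lemma pd_fibre k f g x (O : set 'rV[R]_n) : open O ->
  (forall y, O y -> f (x, y) = g (x, y)) ->
  forall y, O y -> pd k f (x, y) = pd k g (x, y).
Proof.
move=> oO fg y Oy; rewrite pdE !dy_fibre; apply: near_eq_derive.
by apply: filterS fg _; exact: open_nbhs_nbhs.
Qed.

Lemma Ck_sub q (U V : set TRn) f : V `<=` U -> Ck q U f -> Ck q V f.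
Proof.
move=> VU; elim: q f => [|q IH] f [cf df]; split => //.
- by move=> p /VU; exact: cf.
- by move=> p /VU; exact: cf.
by move=> v; have [dv Cv] := df v; split; [move=> p /VU; exact: dv|exact: IH].
Qed.

Lemma smooth_sub (U V : set TRn) f : V `<=` U -> smooth_on U f -> smooth_on V f.
Proof. by move=> VU sf q; exact: Ck_sub (sf q). Qed.

End Fibres.

(** * Vanishing of the third derivatives at generic vectors of one fibre *)

Section GenericFibre.
Context {R : realType} {n : nat}.
Local Notation TRn := ('rV[R]_n * 'rV[R]_n)%type.
Implicit Types (f g : TRn -> R) (p : TRn).
Variables (D : set 'rV[R]_n) (x : 'rV[R]_n) (w : 'I_n -> 'I_n -> TRn -> R).
Variables (o p1 p2 : 'I_n).
Hypotheses (n_gt1 : (1 < n)%N) (oD : open D) (Dx : D x).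
Hypotheses (p12 : p1 != p2) (p1o : p1 != o) (p2o : p2 != o).

(** These are the coordinates by which the normal form divides; [y 0 o] stays free. *)
Definition generic : set 'rV[R]_n := [set y | forall i, i != o -> y 0 i != 0].

Lemma open_generic : open generic.
Proof.
rewrite openE => y Oy; apply: (@filter_forall _ _
  (fun i => [set z : 'rV[R]_n | i != o -> z 0 i != 0]) (nbhs y)) => i.
have [io|io] := eqVneq i o; first exact: nearW.
have oi : open [set z : 'rV[R]_n | z 0 i != 0].
  apply: (@open_comp _ _ (fun z : 'rV[R]_n => z 0 i) [set t | t != 0]); last exact: open_neq.
  by move=> z _; exact: coord_continuous.
by apply: filterS (open_nbhs_nbhs (conj oi (Oy i io))) => z zi _.
Qed.

Let U := slit D.
Let V : set TRn := [set p | D p.1 /\ generic p.2].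

Let oV : open V.
Proof.
apply: openI.
  by apply: (@open_comp _ _ (@fst 'rV[R]_n 'rV[R]_n)) oD => p _; exact: cvg_fst.
by apply: (@open_comp _ _ (@snd 'rV[R]_n 'rV[R]_n)) open_generic => p _; exact: cvg_snd.
Qed.

Let VU : V `<=` U.
Proof.
move=> p [Dp Op]; split => //; apply: contra_neq (Op p1 p1o) => ->.
by rewrite mxE.
Qed.

Hypothesis sw : forall i k, smooth_on U (w i k).
Hypothesis w_tr : forall y, generic y -> \sum_i w i i (x, y) = 0.
Hypothesis w_y : forall i y, generic y -> \sum_k w i k (x, y) * y 0 k = 0.
Hypothesis w_refl1 : forall y r s k, generic y -> r != s -> r != o -> s != o ->
  k != r -> k != s -> y 0 s * w r k (x, y) = y 0 r * w s k (x, y).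
Hypothesis w_refl2 : forall y r s, generic y -> r != s -> r != o -> s != o ->
  y 0 s * (y 0 s * w r s (x, y) - y 0 r * w s s (x, y)) +
  y 0 r * (y 0 s * w r r (x, y) - y 0 r * w s r (x, y)) = 0.
Variable om : 'I_n -> 'I_n -> 'I_n -> TRn -> R.
Hypothesis w_cyc : forall i j k l y, generic y ->
  pd j (pd k (w i l)) (x, y) + pd l (pd j (w i k)) (x, y) +
  pd k (pd l (w i j)) (x, y) = om j k l (x, y) * y 0 i.

(** Row [p1] divided by [y^{p1}], except for its diagonal entry, which also contains [a]; row [p2]
    supplies that coefficient. *)
Let eta k p := if k == p1 then w p2 p1 p * (p.2 0 p2)^-1 else w p1 k p * (p.2 0 p1)^-1.
Let a p := w p1 p1 p - eta p1 p * p.2 0 p1.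
Let gamma k p := w o k p - (o == k)%:R * a p - eta k p * p.2 0 o.
(** Smooth on all of [V], whereas its equality with [w] is asserted only over [x]. *)
Let w' i k p := (i == k)%:R * a p + eta k p * p.2 0 i + (i == o)%:R * gamma k p.

Let sw' i k : smooth_on V (w i k) := smooth_sub VU (@sw i k).
Let sy i : smooth_on V (fun p => p.2 0 i) := smooth_snd_coord oV i.

Let s_eta k : smooth_on V (eta k).
Proof.
have sV i : i != o -> smooth_on V (fun p => (p.2 0 i)^-1).
  by move=> io; apply: (smoothV oV) (sy i) => p [_ /(_ i io)].
by rewrite /eta; case: (k == p1); exact: (smoothM oV (sw' _ _) (sV _ _)).
Qed.

Let s_a : smooth_on V a := smoothB oV (sw' p1 p1) (smoothM oV (s_eta p1) (sy p1)).

Let s_gamma k : smooth_on V (gamma k) :=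
  smoothB oV (smoothB oV (sw' o k) (smoothM oV (smooth_cst oV (o == k)%:R) s_a))
    (smoothM oV (s_eta k) (sy o)).

Let w_eq i k y : generic y -> w i k (x, y) = w' i k (x, y).
Proof.
move=> Oy; exact: (@reflection_structure R _ o p1 p2 (fun i k => w i k (x, y))
  (fun i => y 0 i) p12 p1o p2o Oy (fun r s k => @w_refl1 y r s k Oy) (fun r s => @w_refl2 y r s Oy) i k).
Qed.

Let pd_comb (c d : R) f g h k i p : smooth_on V f -> smooth_on V g -> smooth_on V h ->
  V p -> pd k (fun q => c * f q + g q * q.2 0 i + d * h q) p =
  c * pd k f p + (pd k g p * p.2 0 i + g p * (k == i)%:R) + d * pd k h p.
Proof.
move=> sf sg sh Vp.
have s1 := smoothM oV (smooth_cst oV c) sf.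
have s2 := smoothM oV sg (sy i).
have s3 := smoothM oV (smooth_cst oV d) sh.
rewrite (pdD k (smoothD oV s1 s2) s3 Vp) (pdD k s1 s2 Vp).
by rewrite (pdMl k _ sf Vp) (pdMl k _ sh Vp) (pdM k sg (sy i) Vp) pd_coord.
Qed.

Let pd1 i k j p : V p -> pd j (w' i k) p =
  (i == k)%:R * pd j a p + pd j (eta k) p * p.2 0 i
  + (i == o)%:R * pd j (gamma k) p + eta k p * (j == i)%:R.
Proof.
by move=> Vp; rewrite (pd_comb _ _ _ _ s_a (s_eta k) (s_gamma k) Vp); ring.
Qed.

Let pd2 i k j l p : V p -> pd l (pd j (w' i k)) p =
  (i == k)%:R * pd l (pd j a) p + pd l (pd j (eta k)) p * p.2 0 i
  + (i == o)%:R * pd l (pd j (gamma k)) p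
  + (pd j (eta k) p * (l == i)%:R + pd l (eta k) p * (j == i)%:R).
Proof.
move=> Vp.
have sa := smooth_pd j s_a; have se := smooth_pd j (s_eta k).
have sg := smooth_pd j (s_gamma k).
have sc c := smooth_cst oV c.
have s1 := smoothD oV (smoothD oV (smoothM oV (sc (i == k)%:R) sa) (smoothM oV se (sy i)))
   (smoothM oV (sc (i == o)%:R) sg).
have s2 := smoothM oV (s_eta k) (sc (j == i)%:R).
rewrite (pd_eq oV l (@pd1 i k j) Vp) (pdD l s1 s2 Vp).
rewrite (pd_comb _ _ _ _ sa se sg Vp) (pdM l (s_eta k) (sc _) Vp) pd_cst mulr0 addr0.
ring.
Qed.

Let pd3 i k j l m p : V p -> pd m (pd l (pd j (w' i k))) p =
  (i == k)%:R * pd m (pd l (pd j a)) p + pd m (pd l (pd j (eta k))) p * p.2 0 i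
  + (i == o)%:R * pd m (pd l (pd j (gamma k))) p
  + (pd l (pd j (eta k)) p * (m == i)%:R +
     (pd m (pd j (eta k)) p * (l == i)%:R + pd m (pd l (eta k)) p * (j == i)%:R)).
Proof.
move=> Vp.
have sa := smooth_pd l (smooth_pd j s_a).
have se := smooth_pd l (smooth_pd j (s_eta k)).
have sg := smooth_pd l (smooth_pd j (s_gamma k)).
have sc c := smooth_cst oV c.
have s1 := smoothD oV (smoothD oV (smoothM oV (sc (i == k)%:R) sa) (smoothM oV se (sy i)))
   (smoothM oV (sc (i == o)%:R) sg).
have s2 := smoothM oV (smooth_pd j (s_eta k)) (sc (l == i)%:R).
have s3 := smoothM oV (smooth_pd l (s_eta k)) (sc (j == i)%:R).
rewrite (pd_eq oV m (@pd2 i k j l) Vp) (pdD m s1 (smoothD oV s2 s3) Vp) (pdD m s2 s3 Vp).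
rewrite (pd_comb _ _ _ _ sa se sg Vp).
rewrite (pdM m (smooth_pd j (s_eta k)) (sc _) Vp) (pdM m (smooth_pd l (s_eta k)) (sc _) Vp).
rewrite !pd_cst !mulr0 !addr0.
ring.
Qed.

Let fib k f g : (forall y, generic y -> f (x, y) = g (x, y)) ->
  forall y, generic y -> pd k f (x, y) = pd k g (x, y).
Proof. by move=> fg; exact: (pd_fibre k open_generic fg). Qed.

Let Vx y : generic y -> V (x, y). Proof. by []. Qed.

Let w2_eq i k j l y : generic y -> pd l (pd j (w i k)) (x, y) = pd l (pd j (w' i k)) (x, y).
Proof. by apply: fib; apply: fib; exact: w_eq. Qed.

(** The components [i <> o] of the cyclic condition do not contain [gamma], so [sym_rank_one_eq0]
    applies to them; the component [o] then leaves the cyclic sum of [gamma]. *)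
Let hess_sum j k l y : generic y ->
  pd j (pd k a) (x, y) + pd j (eta k) (x, y) + pd k (eta j) (x, y) = 0 /\
  pd j (pd k (gamma l)) (x, y) + pd j (pd l (gamma k)) (x, y) +
  pd k (pd l (gamma j)) (x, y) = 0.
Proof.
move=> Oy; have Vp := Vx Oy.
(* [h] gathers the coefficients of the Kronecker deltas, and [Om] everything proportional to
   [y^i]. *)
pose h j k := pd j (pd k a) (x, y) + pd j (eta k) (x, y) + pd k (eta j) (x, y).
pose Om j k l := om j k l (x, y) - (pd j (pd k (eta l)) (x, y) +
  pd j (pd l (eta k)) (x, y) + pd k (pd l (eta j)) (x, y)).
have hs j' k' : h j' k' = h k' j'.
  by rewrite /h (pdC oV j' k' s_a Vp) addrAC.
have H i j' k' l' : (i == l')%:R * h j' k' + (i == j')%:R * h k' l' + (i == k')%:R * h j' l'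
   + (i == o)%:R * (pd j' (pd k' (gamma l')) (x, y) + pd j' (pd l' (gamma k')) (x, y) +
      pd k' (pd l' (gamma j')) (x, y)) = Om j' k' l' * y 0 i.
  have := w_cyc i j' k' l' Oy.
  rewrite !w2_eq // !(pd2 _ _ _ _ Vp) /=.
  rewrite (pdC oV l' j' (s_gamma k') Vp) (pdC oV l' j' (s_eta k') Vp) (pdC oV l' j' s_a Vp).
  rewrite /Om /h (eq_sym j' i) (eq_sym k' i) (eq_sym l' i).
  move: (om j' k' l' (x, y)) (pd j' (pd k' a) (x, y)) (pd j' (pd l' a) (x, y)) (pd k' (pd l' a) (x, y)).
  move: (pd j' (pd k' (gamma l')) (x, y)) (pd j' (pd l' (gamma k')) (x, y)) (pd k' (pd l' (gamma j')) (x, y)).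
  move: (pd j' (pd k' (eta l')) (x, y)) (pd j' (pd l' (eta k')) (x, y)) (pd k' (pd l' (eta j')) (x, y)).
  move: (pd j' (eta k') (x, y)) (pd j' (eta l') (x, y)) (pd k' (eta j') (x, y)).
  move: (pd k' (eta l') (x, y)) (pd l' (eta j') (x, y)) (pd l' (eta k') (x, y)).
  move: (y 0 i) ((i == l')%:R : R) ((i == j')%:R : R) ((i == k')%:R : R) ((i == o)%:R : R).
  move=> yi dl dj dk d0 e1 e2 e3 e4 e5 e6 g1 g2 g3 c1 c2 c3 omv a1 a2 a3 E.
  by rewrite mulrBl -E; ring.
have [h0 Om0] : (forall j k, h j k = 0) /\ forall j k l, Om j k l = 0.
  apply: (@sym_rank_one_eq0 R _ o p1 p2 h (fun i => y 0 i) Om) => //.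
  - exact: Oy.
  - exact: Oy.
  by move=> i j' k' l' io; rewrite -H (negbTE io) mul0r addr0.
split; first exact: h0.
have := H o j k l; rewrite eqxx mul1r !h0 Om0 !mulr0 !add0r mul0r.
by [].
Qed.

Let c : R := - (n%:R - 1)^-1.

(** With [s = eta_k y^k], the trace gives [n a + s + gamma_o = 0] and the component [p1] of
    [W y = 0] gives [(a + s) y^{p1} = 0]. *)
Let a_gamma y : generic y -> a (x, y) = c * gamma o (x, y).
Proof.
move=> Oy; pose s := \sum_k eta k (x, y) * y 0 k.
have y1 := Oy p1 p1o.
have E1 : n%:R * a (x, y) + s + gamma o (x, y) = 0.
  rewrite -(w_tr Oy); under [RHS]eq_bigr => i _ do rewrite (w_eq i i Oy) /w' eqxx mul1r.
  rewrite 2!big_split /= sumr_const card_ord mulr_natl; congr (_ + _ + _).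
  rewrite (bigD1 o) //= eqxx mul1r big1 ?addr0 // => i io.
  by rewrite (negbTE io) mul0r.
have E2 : (a (x, y) + s) * y 0 p1 = 0.
  rewrite -(w_y p1 Oy).
  under [RHS]eq_bigr => k _ do rewrite (w_eq p1 k Oy) /w' (negbTE p1o) mul0r addr0 mulrDl.
  rewrite big_split /= mulrDl; congr (_ + _).
    rewrite (bigD1 p1) //= eqxx mul1r big1 ?addr0 // => k kp.
    by rewrite eq_sym (negbTE kp) !mul0r.
  by rewrite /s mulr_suml; apply: eq_bigr => k _; rewrite mulrAC.
have {}E2 : a (x, y) + s = 0.
  by move/eqP: E2; rewrite mulf_eq0 (negbTE y1) orbF => /eqP.
have n1 : (n%:R - 1 : R) != 0.
  by rewrite subr_eq0 (eqr_nat R n 1); case: (n) n_gt1 => [|[]].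
apply: (mulfI n1); rewrite /c mulrA mulrN divff // mulN1r.
by move: E1 E2; move: (a (x, y)) (gamma o (x, y)) s => ? ? ?; lra.
Qed.

Let fib0 k f : (forall y, generic y -> f (x, y) = 0) ->
  forall y, generic y -> pd k f (x, y) = 0.
Proof.
by move=> f0 y Oy; rewrite (@fib k f (fun=> 0) f0 y Oy) pd_cst.
Qed.

(** One more derivative of the cyclic identity in [hess_sum] gives the four-index identity of
    [sym_cyclic_eq0]. *)
Let gamma3 j k l m y : generic y -> pd j (pd k (pd l (gamma m))) (x, y) = 0.
Proof.
move=> Oy; have Vp := Vx Oy.
pose T j k l m := pd j (pd k (pd l (gamma m))) (x, y).
have s23 i1 i2 i3 i4 : T i1 i2 i3 i4 = T i1 i3 i2 i4.
  by apply: (pd_eq oV _ _ Vp) => q Vq; exact: (pdC oV _ _ (s_gamma i4) Vq).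
apply: (@sym_cyclic_eq0 R _ T) => [i1 i2 i3 i4|//|i1 i2 i3 i4].
  exact: (pdC oV _ _ (smooth_pd i3 (s_gamma i4)) Vp).
rewrite (s23 i1 i4 i2 i3) /T.
have s1 := smooth_pd i2 (smooth_pd i3 (s_gamma i4)).
have s2 := smooth_pd i2 (smooth_pd i4 (s_gamma i3)).
have s3 := smooth_pd i3 (smooth_pd i4 (s_gamma i2)).
rewrite -(pdD i1 s1 s2 Vp) -(pdD i1 (smoothD oV s1 s2) s3 Vp).
by apply: fib0 Oy => z Oz; have [] := hess_sum i2 i3 i4 Oz.
Qed.

Let a3 j k l y : generic y -> pd j (pd k (pd l a)) (x, y) = 0.
Proof.
move=> Oy; have sg := s_gamma o.
have A1 z : generic z -> pd l a (x, z) = c * pd l (gamma o) (x, z).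
  by move=> Oz; rewrite (@fib l a (fun p => c * gamma o p) a_gamma z Oz) (pdMl _ _ sg (Vx Oz)).
have A2 z : generic z -> pd k (pd l a) (x, z) = c * pd k (pd l (gamma o)) (x, z).
  move=> Oz; have E := @fib k (pd l a) (fun p => c * pd l (gamma o) p) A1 z Oz.
  by rewrite E (pdMl _ _ (smooth_pd l sg) (Vx Oz)).
have E := @fib j (pd k (pd l a)) (fun p => c * pd k (pd l (gamma o)) p) A2 y Oy.
by rewrite E (pdMl _ _ (smooth_pd k (smooth_pd l sg)) (Vx Oy)) (gamma3 _ _ _ _ Oy) mulr0.
Qed.

Let eta2 j k l y : generic y -> pd j (pd k (eta l)) (x, y) = 0.
Proof.
move=> Oy; have Vp := Vx Oy.
pose T j k l := pd j (pd k (eta l)) (x, y).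
apply: (@sym_antisym_eq0 R _ T) => i1 i2 i3.
  exact: (pdC oV _ _ (s_eta i3) Vp).
have sa := smooth_pd i2 (smooth_pd i3 s_a).
have s2 := smooth_pd i2 (s_eta i3); have s3 := smooth_pd i3 (s_eta i2).
have E : pd i1 (fun p => pd i2 (pd i3 a) p + pd i2 (eta i3) p + pd i3 (eta i2) p) (x, y) = 0.
  by apply: fib0 Oy => z Oz; have [] := hess_sum i2 i3 o Oz.
by rewrite (pdD i1 (smoothD oV sa s2) s3 Vp) (pdD i1 sa s2 Vp) (a3 _ _ _ Oy) add0r in E.
Qed.

Lemma generic_third_eq0 i k j l m y : generic y ->
  pd m (pd l (pd j (w i k))) (x, y) = 0.
Proof.
move=> Oy; have -> : pd m (pd l (pd j (w i k))) (x, y) = pd m (pd l (pd j (w' i k))) (x, y).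
  by apply: fib Oy; exact: w2_eq.
rewrite (pd3 _ _ _ _ _ (Vx Oy)) (a3 _ _ _ Oy) (gamma3 _ _ _ _ Oy) !(eta2 _ _ _ Oy).
have -> : pd m (pd l (pd j (eta k))) (x, y) = 0 by apply: fib0 Oy => z Oz; exact: eta2.
by rewrite !(mulr0, mul0r, addr0).
Qed.

End GenericFibre.

(** * Householder reflections and the Euclidean ball *)

Section Householder.
Context {R : realFieldType} {n : nat}.
Implicit Types (u x y z : 'rV[R]_n).

Definition householder z : 'M[R]_n := 1%:M - (2 / (z *m z^T) 0 0) *: (z^T *m z).

Lemma dot_gt0 z : z != 0 -> 0 < (z *m z^T) 0 0.
Proof.
move=> z0; rewrite mxE lt_neqAle eq_sym; apply/andP; split.
  apply: contra_neq z0 => /eqP; rewrite psumr_eq0 => [/allP s0|i _].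
    apply/rowP => i; rewrite mxE; apply/eqP.
    by have := s0 i (mem_index_enum i); rewrite mxE mulf_eq0 orbb.
  by rewrite mxE -expr2 sqr_ge0.
by apply: sumr_ge0 => i _; rewrite mxE -expr2 sqr_ge0.
Qed.

Lemma householder_tr z : (householder z)^T = householder z.
Proof. by rewrite /householder linearB linearZ /= trmx1 trmx_mul trmxK. Qed.

Lemma mul_householder u z :
  u *m householder z = u - (2 / (z *m z^T) 0 0 * (u *m z^T) 0 0) *: z.
Proof.
rewrite mulmxBr mulmx1 -scalemxAr mulmxA {1}[u *m z^T]mx11_scalar mul_scalar_mx.
by rewrite scalerA.
Qed.

Lemma householder_orth z : z != 0 -> householder z *m (householder z)^T = 1%:M.
Proof.
move=> /dot_gt0 z0; rewrite householder_tr.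
rewrite {2}/householder mulmxBr mulmx1 -scalemxAr.
have zH : householder z *m (z^T *m z) = - (z^T *m z).
  rewrite -[householder z]householder_tr mulmxA -trmx_mul mul_householder.
  by rewrite divfK ?gt_eqF// scaler_nat mulr2n opprD addNKr linearN mulNmx.
by rewrite zH scalerN opprK /householder subrK.
Qed.

Lemma householder_fix u z : u *m z^T = 0 -> u *m householder z = u.
Proof.
move=> uz; have uz0 : (u *m z^T) 0 0 = 0 by rewrite uz mxE.
by rewrite mul_householder uz0 mulr0 scale0r subr0.
Qed.

(** The reflection along [x - y] works: for equal lengths [|x - y|^2 = 2 <x, x - y>], so it
    subtracts exactly [x - y] from [x]. *)
Lemma exists_orth_map x y : (x *m x^T) 0 0 = (y *m y^T) 0 0 ->
  exists A : 'M[R]_n, A *m A^T = 1%:M /\ x *m A = y.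
Proof.
move=> xy; have [->|nxy] := eqVneq x y.
  by exists 1%:M; rewrite trmx1 !mulmx1.
have z0 : x - y != 0 by rewrite subr_eq0.
exists (householder (x - y)); split; first exact: householder_orth.
have dz := dot_gt0 z0.
rewrite mul_householder; suff -> : (2 / ((x - y) *m (x - y)^T) 0 0 *
    (x *m (x - y)^T) 0 0) = 1 by rewrite scale1r subKr.
have E : ((x - y) *m (x - y)^T) 0 0 = 2 * (x *m (x - y)^T) 0 0.
  have yx : (y *m x^T) 0 0 = (x *m y^T) 0 0.
    by rewrite -[in RHS](trmxK x) -trmx_mul [RHS]mxE.
  have sub u v w : (u *m (v - w)^T) 0 0 = (u *m v^T) 0 0 - (u *m w^T) 0 0.
    by rewrite linearB mulmxBr !mxE.
  have subl u v w : ((v - w) *m u^T) 0 0 = (v *m u^T) 0 0 - (w *m u^T) 0 0.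
    by rewrite mulmxBl !mxE.
  by rewrite !sub !subl yx -xy; ring.
by rewrite mulrAC -E divff // gt_eqF.
Qed.

End Householder.

Section EuclideanBall.
Context {R : realType} {n : nat}.
Implicit Types (x : 'rV[R]_n) (A : 'M[R]_n).

Lemma enorm_dot x : enorm x = Num.sqrt ((x *m x^T) 0 0).
Proof. by rewrite /enorm mxE; congr Num.sqrt; apply: eq_bigr => i _; rewrite mxE expr2. Qed.

Lemma enorm_orth A x : A *m A^T = 1%:M -> enorm (x *m A) = enorm x.
Proof. by move=> AA; rewrite !enorm_dot trmx_mul mulmxA -(mulmxA x) AA mulmx1. Qed.

Lemma enorm_continuous : continuous (@enorm R n).
Proof.
have c : continuous (fun z : 'rV[R]_n => \sum_i z 0 i ^+ 2).
  apply: continuous_big => [|i _ z]; first exact: add_continuous.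
  apply: (@continuous_comp _ _ _ (fun z : 'rV[R]_n => z 0 i) (fun t => t ^+ 2)).
    exact: coord_continuous.
  exact: exprn_continuous.
by move=> x; apply: (continuous_comp (c x)); exact: sqrt_continuous.
Qed.

Lemma open_eball (v : \bar R) : open (@eball R n v).
Proof.
case: v => [r| |].
- rewrite (_ : eball _ = enorm @^-1` [set t | t < r]).
    by apply: (@open_comp _ _ (@enorm R n)) (@open_lt R r) => x _; exact: enorm_continuous.
  by apply/seteqP; split=> x; rewrite /eball /= lte_fin.
- rewrite (_ : eball _ = setT); first exact: openT.
  by apply/seteqP; split=> x //= _; rewrite /eball /= ltry.
rewrite (_ : eball _ = set0); first exact: open0.
by apply/seteqP; split=> x.
Qed.

Lemma open_neq0 : open [set y : 'rV[R]_n | y != 0].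
Proof.
rewrite (_ : [set y | y != 0] = ~` [set 0]).
  apply: closed_openC; apply: accessible_closed_set1.
  by apply: hausdorff_accessible; exact: norm_hausdorff.
by apply/seteqP; split=> y /=; [move=> /eqP|move=> /eqP].
Qed.

Lemma open_slit (D : set 'rV[R]_n) : open D -> open (slit D).
Proof.
move=> oD; apply: openI.
  by apply: (@open_comp _ _ (@fst 'rV[R]_n 'rV[R]_n)) oD => p _; exact: cvg_fst.
apply: (@open_comp _ _ (@snd 'rV[R]_n 'rV[R]_n) [set y | y != 0]).
  by move=> p _; exact: cvg_snd.
exact: open_neq0.
Qed.

End EuclideanBall.

(** * Vanishing of the Weyl curvature in dimension two *)

Section DimensionTwo.
Context {R : realType} {n : nat}.
Local Notation TRn := ('rV[R]_n * 'rV[R]_n)%type.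
Variables (D : set 'rV[R]_n) (F : TRn -> R).
Hypotheses (oU : open (slit D)) (finF : finsler_metric D F).

Lemma sum_ord2 (i j : 'I_n) (f : 'I_n -> R) : n = 2%N -> i != j ->
  \sum_m f m = f i + f j.
Proof.
move=> n2 ij; rewrite (bigD1 i) //= (bigD1 j) /=; last by rewrite eq_sym.
rewrite big1 ?addr0 // => m /andP[mi mj]; exfalso.
move: mi mj ij; rewrite -!val_eqE /=; have := ltn_ord i; have := ltn_ord j.
have := ltn_ord m; rewrite [X in (_ < X)%N]n2 [X in (j < X)%N]n2 [X in (i < X)%N]n2.
by move: (val i) (val j) (val m) => [|[|?]] [|[|?]] [|[|?]].
Qed.

(** For a two by two matrix, [M - tr M] is minus the adjugate, whose columns lie in the kernel of
    [M]; they are multiples of [y] when [M y = 0] and [y] is nonzero. *)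
Lemma sub_tr_rank_one (M : 'I_n -> 'I_n -> R) (y : 'I_n -> R) : n = 2%N ->
  (forall i, \sum_k M i k * y k = 0) ->
  forall i j k, y i * (M j k - (\sum_m M m m) * (j == k)%:R) =
                y j * (M i k - (\sum_m M m m) * (i == k)%:R).
Proof.
move=> n2 My i j k; have [-> //|ij] := eqVneq i j.
have ji : j != i by rewrite eq_sym.
have /= -> := sum_ord2 (fun m => M m m) n2 ij.
have /= Ei := etrans (esym (sum_ord2 (fun k => M i k * y k) n2 ij)) (My i).
have /= Ej := etrans (esym (sum_ord2 (fun k => M j k * y k) n2 ij)) (My j).
have [->|ki] := eqVneq k i.
  by rewrite ?eqxx (negbTE ji) mulr0 mulr1; move: Ei Ej; lra.
(* If [k] were neither [i] nor [j], its indicator would sum to [0] over the two indices, although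
   its own term is [1]. *)
have -> : k = j.
  apply/eqP; apply: contraTT isT => kj; have := sum_ord2 (fun m => (m == k)%:R) n2 ij.
  rewrite (bigD1 k) //= eqxx [i == k]eq_sym [j == k]eq_sym (negbTE ki) (negbTE kj) addr0.
  by move=> /eqP; rewrite gt_eqF // ltr_pwDl ?ltr01 // sumr_ge0.
by rewrite eqxx mulr0 mulr1; move: Ei Ej; lra.
Qed.

Lemma weyl_dim2 i k p : n = 2%N -> slit D p -> weyl F i k p = 0.
Proof.
move=> n2 Up; have n1 : (1 < n)%N by rewrite n2.
have H j q : slit D q -> q.2 0 i * weyl_aux F j k q = q.2 0 j * weyl_aux F i k q.
  move=> Uq; have E := sub_tr_rank_one n2 (fun i => riemann_y oU finF i Uq) i j k.
  (* In dimension two [R] is the full trace, so [A] is the Riemann curvature minus its trace. *)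
  have n11 : (n%:R - 1 : R)^-1 = 1 by rewrite n2 -[2]/(1 + 1) addrK invr1.
  by rewrite /weyl_aux /ricci_scalar n11 mul1r; exact: E.
have sA := smooth_weyl_aux oU finF; have sy := smooth_snd_coord oU.
have E j : (j == i)%:R * weyl_aux F j k p + p.2 0 i * pd j (weyl_aux F j k) p =
    weyl_aux F i k p + pd j (weyl_aux F i k) p * p.2 0 j.
  have := pd_eq oU j (H j) Up.
  rewrite (pdM j (sy i) (sA j k) Up) (pdM j (sy j) (sA i k) Up) !pd_coord eqxx mul1r.
  by move=> ->; congr (_ + _); exact: mulrC.
(* The divergence over [j], with Euler's identity on the right. It gives
   [y^i A^j_{k.j} = (n + 1) A^i_k], so the two terms of [W] cancel. *)
have S : weyl_aux F i k p + p.2 0 i * \sum_j pd j (weyl_aux F j k) p =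
   n%:R * weyl_aux F i k p + 2 * weyl_aux F i k p.
  have eu := euler_pd oU (homog_weyl_aux oU finF i k) (sA i k) Up.
  rewrite -[X in _ = _ + X]eu mulr_sumr.
  transitivity (\sum_j ((j == i)%:R * weyl_aux F j k p + p.2 0 i * pd j (weyl_aux F j k) p)).
    rewrite big_split /=; congr (_ + _).
    rewrite (bigD1 i) //= eqxx mul1r big1 ?addr0 // => j ji.
    by rewrite (negbTE ji) mul0r.
  rewrite (eq_bigr _ (fun j _ => E j)) big_split /= sumr_const card_ord.
  by rewrite mulr_natl.
have n3 : (n%:R + 1 : R) != 0 := natr1_neq0.
rewrite pdE in S.
rewrite /weyl; apply: (mulfI n3); rewrite mulr0 mulrBr !mulrA divff // mul1r.
move: S; move: (weyl_aux F i k p) (\sum_j _) (p.2 0 i) => z s yi S.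
lra.
Qed.

End DimensionTwo.

(** * Quadratic Weyl curvature *)

Section VanishingOnFibres.
Context {R : realType} {n : nat}.
Local Notation TRn := ('rV[R]_n * 'rV[R]_n)%type.
Implicit Types (f g : TRn -> R).
Variables (D : set 'rV[R]_n) (x : 'rV[R]_n) (o p1 : 'I_n).
Hypotheses (oU : open (slit D)) (Dx : D x) (p1o : p1 != o).
Local Notation U := (slit D).

(** Along the diagonal direction each coordinate vanishes for exactly one [t]. *)
Lemma near_generic (y : 'rV[R]_n) : \forall t \near (0 : R)^', generic o (y + t *: const_mx 1).
Proof.
apply: (@filter_forall _ _ (fun i => [set t : R | i != o ->
  (y + t *: const_mx 1 : 'rV[R]_n) 0 i != 0]) (0 : R)^') => i.
have H : \forall t \near (0 : R)^', t != - y 0 i.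
  have [y0|y0] := eqVneq (y 0 i) 0; first by rewrite y0 oppr0; exact: nbhs_dnbhs_neq.
  apply: cvg_within; apply: open_nbhs_nbhs; split; first exact: open_neq.
  by rewrite /= eq_sym oppr_eq0.
apply: filterS H => t tN _; rewrite !mxE mulr1.
by apply: contra_neq tN => /eqP; rewrite addr_eq0 => /eqP ->; rewrite opprK.
Qed.

(** Generic vectors are dense in the fibre, and [f] would stay nonzero near a point where it is
    nonzero. *)
Lemma eq0_of_generic f : smooth_on U f -> (forall y, generic o y -> f (x, y) = 0) ->
  forall y, y != 0 -> f (x, y) = 0.
Proof.
move=> sf f0 y y0; apply: contrapT => /eqP fy.
have Up : U (x, y) by [].
have near_p : \forall q \near (x, y), f q != 0.
  have e0 : 0 < `|f (x, y)| by rewrite normr_gt0.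
  apply: filterS (smooth_dist sf Up e0) => q; apply: contraTneq => ->.
  by rewrite subr0 ltxx.
have line : (fun t : R => (x, y + t *: const_mx 1) : TRn) @ (0 : R)^' --> (x, y).
  have h1 : (fun=> x) @ (0 : R)^' --> x by exact: cvg_cst.
  have h2 : (fun t : R => y + t *: const_mx 1) @ (0 : R)^' --> y.
    rewrite -[X in _ --> X]addr0; apply: cvgD; first exact: cvg_cst.
    rewrite -[X in _ --> X](scale0r (const_mx 1)); apply: cvgZr_tmp.
    by apply: cvg_within; exact: cvg_id.
  exact: (cvg_pair h1 h2).
have H : \forall t \near (0 : R)^', f (x, y + t *: const_mx 1) != 0 := line _ near_p.
have [t [ft /f0 gt]] : exists t : R, f (x, y + t *: const_mx 1) != 0 /\
    generic o (y + t *: const_mx 1).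
  by apply: (@filter_ex _ (0 : R)^'); apply: filterS2 H (near_generic y).
by rewrite gt eqxx in ft.
Qed.

(** The segment from [e_o] to [y] must avoid the origin. For generic [y] it does, its coordinate
    [p1] being [t * y 0 p1]; the other [y] follow by density. *)
Lemma fibre_constant f : smooth_on U f ->
  (forall k y, y != 0 -> pd k f (x, y) = 0) ->
  forall y, y != 0 -> f (x, y) = f (x, delta_mx 0 o).
Proof.
move=> sf f'0 y y0; apply/eqP; rewrite -subr_eq0; apply/eqP.
apply: (@eq0_of_generic (fun q => f q - f (x, delta_mx 0 o))) y0 => [|{}y Oy].
  exact: (smoothB oU sf (smooth_cst oU _)).
pose v : TRn := (0, y - delta_mx 0 o).
have seg (t : R) : ((x, delta_mx 0 o) : TRn) + t *: v =
    (x, delta_mx 0 o + t *: (y - delta_mx 0 o)).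
  by apply/pair_eqP/andP; split; apply/eqP => //=; rewrite scaler0 addr0.
have seg0 (t : R) : delta_mx 0 o + t *: (y - delta_mx 0 o) != 0.
  have [->|t0] := eqVneq t 0.
    rewrite scale0r addr0; apply/eqP => /rowP/(_ o); rewrite !mxE !eqxx /=.
    by move/eqP; rewrite oner_eq0.
  apply/eqP => /rowP/(_ p1); rewrite !mxE eqxx /= (negbTE p1o) add0r subr0 => /eqP.
  by rewrite mulf_eq0 (negbTE t0) (negbTE (Oy p1 p1o)).
have [|t _] := @MVT_line R _ f (x, delta_mx 0 o) v.
  by move=> t _; rewrite seg; apply: smooth_derivable sf _; split=> //=; exact: seg0.
rewrite seg; have -> : ((x, delta_mx 0 o) : TRn) + v = (x, y).
  by rewrite -[v]scale1r seg scale1r addrC subrK.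
move=> ->; have Up : U (x, delta_mx 0 o + t *: (y - delta_mx 0 o)) by split=> //=; exact: seg0.
apply: (etrans (derive_snd oU _ sf Up)); apply: big1 => k _.
by have := f'0 k _ (seg0 t); rewrite pdE => ->; rewrite mulr0.
Qed.

(** The vertical Hessian is constant on the fibre, and Euler's identity used twice recovers [f] from
    it. So [Q] is half the Hessian, read off at [e_o]. *)
Lemma quadratic_of_third_eq0 f : smooth_on U f -> homog D 2 f ->
  (forall j l m y, y != 0 -> pd m (pd l (pd j f)) (x, y) = 0) ->
  exists Q : 'M[R]_n, forall y, y != 0 -> f (x, y) = (y *m Q *m y^T) 0 0.
Proof.
move=> sf hf f3.
exists (\matrix_(l, j) (2^-1 * pd l (pd j f) (x, delta_mx 0 o))) => y y0.
have Up : U (x, y) by [].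
have sj j := smooth_pd j sf.
have C j l : pd l (pd j f) (x, y) = pd l (pd j f) (x, delta_mx 0 o).
  by apply: (fibre_constant (smooth_pd l (sj j)) _ y0) => m z z0; exact: f3.
have E1 j : pd j f (x, y) = \sum_l pd l (pd j f) (x, delta_mx 0 o) * y 0 l.
  have := euler_pd oU (homog_pd oU j hf sf) (sj j) Up; rewrite mul1r => <-.
  by apply: eq_bigr => l _; rewrite C.
have E2 := euler_pd oU hf sf Up.
have -> : f (x, y) = 2^-1 * \sum_k pd k f (x, y) * y 0 k by rewrite E2 mulKf.
rewrite mxE mulr_sumr; apply: eq_bigr => j _.
rewrite mulrA; congr (_ * _); last by rewrite mxE.
rewrite E1 mxE mulr_sumr; apply: eq_bigr => l _.
by rewrite [X in _ = _ * X]mxE; ring.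
Qed.

Lemma third_eq0_of_quadratic f (Q : 'M[R]_n) :
  (forall y, y != 0 -> f (x, y) = \sum_a \sum_b Q a b * y 0 a * y 0 b) ->
  forall j l m y, y != 0 -> pd m (pd l (pd j f)) (x, y) = 0.
Proof.
(* [q] extends the form to the whole bundle, independently of the base point, so that the calculus
   on [U] applies to it. *)
move=> fQ j l m y y0; pose q p := \sum_a \sum_b Q a b * (p : TRn).2 0 a * p.2 0 b.
have fib k g h := @pd_fibre R n k g h x [set z | z != 0] open_neq0.
have E0 k z : z != 0 -> pd k f (x, z) = pd k q (x, z) by apply: fib.
have E1 k z : z != 0 -> pd k (pd j f) (x, z) = pd k (pd j q) (x, z).
  by apply: (fib k _ _) => z'; exact: E0.
rewrite (@fib m (pd l (pd j f)) (pd l (pd j q)) (E1 l) y y0).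
have sy i := smooth_snd_coord oU i.
have sQ a b := smoothM oU (smooth_cst oU (Q a b)) (sy a).
have q1 p : U p -> pd j q p = \sum_c (Q j c + Q c j) * p.2 0 c.
  move=> Up.
  rewrite (pd_sum oU j _ (fun a => smooth_sum oU _ (fun b _ => smoothM oU (sQ a b) (sy b))) Up).
  transitivity (\sum_a \sum_b ((j == a)%:R * (Q a b * p.2 0 b) + (j == b)%:R * (Q a b * p.2 0 a))).
    apply: eq_bigr => a _.
    rewrite (pd_sum oU j _ (fun b => smoothM oU (sQ a b) (sy b)) Up).
    apply: eq_bigr => b _.
    by rewrite (pdM j (sQ a b) (sy b) Up) (pdMl j _ (sy a) Up) !pd_coord; ring.
  have pick (g : 'I_n -> R) : \sum_a (j == a)%:R * g a = g j.
    rewrite (bigD1 j) //= eqxx mul1r big1 ?addr0 // => a aj.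
    by rewrite eq_sym (negbTE aj) mul0r.
  under eq_bigr do rewrite big_split /= pick -mulr_sumr.
  by rewrite big_split /= pick -big_split; apply: eq_bigr => c _; rewrite mulrDl.
have sL c := smoothM oU (smooth_cst oU (Q j c + Q c j)) (sy c).
have q2 p : U p -> pd l (pd j q) p = \sum_c (Q j c + Q c j) * (l == c)%:R.
  move=> Up; rewrite (pd_eq oU l q1 Up) (pd_sum oU l _ sL Up).
  by apply: eq_bigr => c _; rewrite (pdMl l _ (sy c) Up) pd_coord.
have Up : U (x, y) by [].
by rewrite (pd_eq oU m q2 Up) pd_cst.
Qed.

End VanishingOnFibres.

(** * The two implications *)

Section WeylQuadratic.
Context {R : realType} {n : nat}.
Local Opaque derive derivable dx dy smooth_on.
Local Notation TRn := ('rV[R]_n * 'rV[R]_n)%type.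
Variables (D : set 'rV[R]_n) (F : TRn -> R).
Hypotheses (oD : open D) (finF : finsler_metric D F) (n_gt1 : (1 < n)%N).
Local Notation U := (slit D).
Let oU : open U := open_slit oD.

(** The third derivatives of [W] vanish, hence so does the weakly-Weyl curvature, and the zero
    tensor serves as [omega]. *)
Lemma weakly_weyl_of_quadratic : W_quadratic D F -> weakly_weyl D F.
Proof.
move=> Wq; exists (fun _ _ _ _ => 0); split.
- by move=> *; exact: smooth_cst.
- move=> j i k l [x y] [/= Dx y0]; rewrite mul0r (weakly_weyl_curv_third oU finF) //.
  rewrite big1 ?mulr0 // => h _.
  have [Q1 W1] := Wq x Dx i h; have [Q2 W2] := Wq x Dx i l.
  by rewrite (third_eq0_of_quadratic oU Dx W1) // (third_eq0_of_quadratic oU Dx W2) // subrr mul0r.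
exists (fun=> 0) => j k l p Up; rewrite !mul0r addr0 /hcov0.
apply: big1 => m _; suff -> : hcov F (fun _ _ _ _ => 0) j k l m p = 0 by rewrite mul0r.
transitivity (0 - 0 - 0 - 0 - 0 : R); last by rewrite !subr0.
congr (_ - _ - _ - _ - _); first exact: derive_cst.
- by apply: big1 => r _; apply: (etrans (congr1 _ (dy_cst r 0 p))); exact: mulr0.
- by apply: big1 => r _; exact: mulr0.
- by apply: big1 => r _; exact: mulr0.
- by apply: big1 => r _; exact: mulr0.
Qed.

Hypothesis symF : spherically_symmetric D F.
Hypothesis DA : forall (A : 'M[R]_n) x, A *m A^T = 1%:M -> D x -> D (x *m A).

Let weylA (A : 'M[R]_n) (AA : A *m A^T = 1%:M) :=
  mx_act_weyl oU finF AA (fun x => DA AA) (symF AA).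

(** Equivariance under a reflection fixing [(x, y)] makes [W] commute with it, hence with
    [z^T *m z]; the identity is the entry [(i, k)] of this commutation. *)
Lemma weyl_reflection (z x y : 'rV[R]_n) i k : z != 0 -> x *m z^T = 0 -> y *m z^T = 0 ->
  U (x, y) ->
  z 0 i * (\sum_a z 0 a * weyl F a k (x, y)) = (\sum_b weyl F i b (x, y) * z 0 b) * z 0 k.
Proof.
move=> z0 xz yz Up; have HH := householder_orth z0.
have := weylA HH Up; rewrite /= !householder_fix //.
set M := mx_of _ _ => E.
have HM : householder z *m M = M *m householder z.
  rewrite {1}E householder_tr !mulmxA.
  by have := HH; rewrite householder_tr => ->; rewrite mul1mx.
have c0 : 2 / (z *m z^T) 0 0 != 0 by rewrite mulf_neq0 // invr_neq0 // gt_eqF // dot_gt0.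
have zM : z^T *m z *m M = M *m (z^T *m z).
  move: HM; rewrite /householder mulmxBl mulmxBr mul1mx mulmx1 => /addrI/oppr_inj.
  by rewrite -scalemxAl -scalemxAr => /(scalerI c0).
have := congr1 (fun N : 'M[R]_n => N i k) zM.
have -> : (z^T *m z *m M) i k = z 0 i * (\sum_a z 0 a * weyl F a k (x, y)).
  rewrite -mulmxA mxE big_ord1 [X in X * _]mxE; congr (_ * _).
  by rewrite mxE; apply: eq_bigr => a _; rewrite [X in _ * X]mxE.
move=> ->; rewrite mulmxA mxE big_ord1; congr (_ * _).
rewrite mxE; apply: eq_bigr => b _.
by rewrite [X in X * _]mxE [X in _ * X]mxE.
Qed.

Section AxisFibre.
Variables (o p1 p2 : 'I_n) (r : R).
Hypotheses (p12 : p1 != p2) (p1o : p1 != o) (p2o : p2 != o).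
Let x : 'rV[R]_n := r *: delta_mx 0 o.
Hypothesis Dx : D x.

(** Orthogonal to [y], and also to the axis point [x] when [i] and [j] differ from [o]. *)
Let reflection_vector (y : 'rV[R]_n) (i j : 'I_n) : 'rV[R]_n :=
  y 0 j *: delta_mx 0 i - y 0 i *: delta_mx 0 j.

Let sum_refl (y : 'rV[R]_n) i j (f : 'I_n -> R) :
  \sum_a (y 0 j * (a == i)%:R - y 0 i * (a == j)%:R) * f a = y 0 j * f i - y 0 i * f j.
Proof.
under eq_bigr do rewrite mulrBl; rewrite sumrB.
by congr (_ - _); [rewrite (bigD1 i)|rewrite (bigD1 j)] => //=;
  rewrite eqxx mulr1 big1 ?addr0 // => a /negbTE ->; rewrite mulr0 mul0r.
Qed.

Let reflE y i j a : reflection_vector y i j 0 a = y 0 j * (a == i)%:R - y 0 i * (a == j)%:R.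
Proof. by rewrite !mxE !eqxx. Qed.

Let refl_orth (u y : 'rV[R]_n) i j : u 0 i * y 0 j = u 0 j * y 0 i -> u *m (reflection_vector y i j)^T = 0.
Proof.
move=> uy; apply/matrixP => a b; rewrite !ord1 [LHS]mxE [RHS]mxE.
under eq_bigr do rewrite [X in _ * X]mxE reflE mulrC.
by rewrite sum_refl mulrC uy mulrC subrr.
Qed.

Let weyl_refl y i j a b : generic o y -> i != j -> i != o -> j != o ->
  let L k := y 0 j * weyl F i k (x, y) - y 0 i * weyl F j k (x, y) in
  let N k := y 0 j * weyl F k i (x, y) - y 0 i * weyl F k j (x, y) in
  (y 0 j * (a == i)%:R - y 0 i * (a == j)%:R) * L b =
  N a * (y 0 j * (b == i)%:R - y 0 i * (b == j)%:R).
Proof.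
move=> Oy ij io jo L N; pose z := reflection_vector y i j.
have yj := Oy j jo.
have z0 : z != 0.
  apply/eqP => /rowP/(_ i); rewrite reflE mxE eqxx (negbTE ij) mulr0 subr0 mulr1.
  by move/eqP; rewrite (negbTE yj).
have y0 : y != 0 by apply: contra_neq yj => ->; rewrite mxE.
have xz : x *m z^T = 0.
  by apply: refl_orth; rewrite !mxE (negbTE io) (negbTE jo) andbF !mulr0 !mul0r.
have yz : y *m z^T = 0 by apply: refl_orth; rewrite mulrC.
have Up : U (x, y) by [].
have := weyl_reflection a b z0 xz yz Up; rewrite !reflE.
under eq_bigr do rewrite reflE.
rewrite sum_refl => ->; congr (_ * _).
by under eq_bigr do rewrite reflE mulrC; rewrite sum_refl.
Qed.

Lemma weyl_third_eq0 : weakly_weyl D F ->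
  forall i k j l m y, y != 0 -> pd m (pd l (pd j (weyl F i k))) (x, y) = 0.
Proof.
move=> [om [_ Hom _]] i k j l m; have sW := smooth_weyl oU finF.
have s3 := smooth_pd m (smooth_pd l (smooth_pd j (sW i k))).
apply: (@eq0_of_generic R n D x o Dx _ s3) => y Oy.
have Uy z : generic o z -> U (x, z).
  by move=> Oz; split => //=; apply: contra_neq (Oz p1 p1o) => ->; rewrite mxE.
(* The factor [- 3] undoes the [- 3^-1] of [weakly_weyl_curvE]. *)
apply: (@generic_third_eq0 R n D x (weyl F) o p1 p2 n_gt1 oD Dx p12 p1o p2o sW
  _ _ _ _ (fun j k l p => - (3 * om j k l p))) Oy.
- by move=> z Oz; exact: (weyl_tr oU finF n_gt1 (Uy z Oz)).
- by move=> a z Oz; exact: (weyl_y oU finF n_gt1 a (Uy z Oz)).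
- move=> z r' s b Oz rs ro so br bs.
  have /= := weyl_refl r' b Oz rs ro so; rewrite eqxx (negbTE rs) (negbTE br) (negbTE bs).
  rewrite !mulr0 subr0 mulr1 subrr mulr0 => /eqP.
  by rewrite mulf_eq0 (negbTE (Oz s so)) subr_eq0 => /eqP.
- move=> z r' s Oz rs ro so.
  (* In the notation of [weyl_refl], [E1] gives [L r' = N r'] and [E2] gives
     [z_s L s = - z_{r'} N r']. *)
  have /= E1 := weyl_refl r' r' Oz rs ro so; have /= E2 := weyl_refl r' s Oz rs ro so.
  move: E1 E2; rewrite !eqxx (negbTE rs) eq_sym (negbTE rs).
  rewrite !mulr0 !subr0 !mulr1 sub0r => E1 E2.
  have zs := Oz s so.
  have {}E1 := mulIf zs (etrans (mulrC _ _) E1).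
  by rewrite E2 -E1; ring.
move=> a b c d z Oz.
have := Hom b a c d (x, z) (Uy z Oz); rewrite (weakly_weyl_curvE oU finF n_gt1) //=; last exact: Uy.
by rewrite mulNr -mulrA => <-; rewrite mulrN opprK mulVKf // pnatr_eq0.
Qed.

End AxisFibre.

Lemma quadratic_of_weakly_weyl : weakly_weyl D F -> W_quadratic D F.
Proof.
move=> Wf x Dx i k; have [n2|n2] := eqVneq n 2%N.
  exists 0 => y y0; rewrite (weyl_dim2 oU finF) //.
  by rewrite big1 // => a _; rewrite big1 // => b _; rewrite mxE !mul0r.
have n3 : (2 < n)%N by rewrite ltn_neqAle eq_sym n2 n_gt1.
pose o : 'I_n := Ordinal (ltnW n_gt1).
pose p1 : 'I_n := Ordinal n_gt1.
pose p2 : 'I_n := Ordinal n3.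
(* The point of the axis at the same distance from the origin as [x], to which an orthogonal map
   carries [x]. *)
pose x0 : 'rV[R]_n := enorm x *: delta_mx 0 o.
have [A [AA xA]] : exists A : 'M[R]_n, A *m A^T = 1%:M /\ x *m A = x0.
  apply: exists_orth_map.
  have -> : (x0 *m x0^T) 0 0 = enorm x ^+ 2.
    rewrite mxE (bigD1 o) //= big1 => [|a /negbTE ao]; rewrite !mxE ?eqxx ?ao /=.
      by rewrite addr0 mulr1 expr2.
    by rewrite !mulr0.
  rewrite enorm_dot sqr_sqrtr //.
  by rewrite mxE; apply: sumr_ge0 => a _; rewrite mxE -expr2 sqr_ge0.
have Dx0 : D x0 by rewrite -xA; exact: DA.
have T := @weyl_third_eq0 o p1 p2 (enorm x) isT isT isT Dx0 Wf.
have sW := smooth_weyl oU finF; have hW := homog_weyl oU finF.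
have /choice[Q HQ] : forall ab : 'I_n * 'I_n, exists Q : 'M[R]_n, forall y, y != 0 ->
    weyl F ab.1 ab.2 (x0, y) = (y *m Q *m y^T) 0 0.
  move=> [a b] /=.
  by apply: (@quadratic_of_third_eq0 R n D x0 o p1 oU Dx0 isT) => //; exact: T.
(* [Q (a, b)] represents [W^a_b] over [x0] in the variable [y *m A]. Conjugation by [A] rewrites it
   in [y], and the weights come from [W(x, y) = A W(x0, y A) A^T]. *)
exists (\sum_b \sum_a (A i a * A k b) *: (A *m Q (a, b) *m A^T)) => y y0.
have Up : U (x, y) by [].
have yA0 : y *m A != 0 by have [] := slit_act AA (fun x => DA AA) Up.
have E : weyl F i k (x, y) = (A *m mx_of (weyl F) (x0, y *m A) *m A^T) i k.
  rewrite -xA -[X in mx_of _ X]/((x, y).1 *m A, (x, y).2 *m A) (weylA AA Up).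
  by rewrite !mulmxA AA mul1mx -mulmxA AA mulmx1 [RHS]mxE.
rewrite E mxE.
transitivity ((y *m (\sum_b \sum_a (A i a * A k b) *: (A *m Q (a, b) *m A^T)) *m y^T) 0 0).
  rewrite mulmx_sumr mulmx_suml summxE; apply: eq_bigr => b _.
  rewrite mulmx_sumr mulmx_suml summxE mxE mulr_suml; apply: eq_bigr => a _.
  rewrite -scalemxAr -scalemxAl [RHS]mxE [X in _ * X * _]mxE [X in _ * X = _]mxE.
  rewrite (HQ (a, b) _ yA0) mulrAC; congr (_ * _).
  by rewrite trmx_mul !mulmxA.
rewrite mxE [RHS]exchange_big /=; apply: eq_bigr => b _.
rewrite [X in _ * X]mxE mxE mulr_suml; apply: eq_bigr => a _.
by rewrite [y 0 a * _]mulrC.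
Qed.

End WeylQuadratic.

Theorem theorem2p5 (R : realType) (n : nat) (v : \bar R)
    (F : 'rV[R]_n * 'rV[R]_n -> R) :
  (2 <= n)%N -> (0 < v)%E ->
  finsler_metric (eball v) F ->
  spherically_symmetric (eball v) F ->
  weakly_weyl (eball v) F <-> W_quadratic (eball v) F.
Proof.
move=> n_gt1 _ finF symF; have oD := @open_eball R n v; split.
  apply: (quadratic_of_weakly_weyl oD finF n_gt1 symF) => A x AA.
  by rewrite /eball /= enorm_orth.
exact: (weakly_weyl_of_quadratic oD finF).
Qed.
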